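(* Within each of the three classes $\mathfrak{R}=\{R_\alpha : 0<\alpha\le 1\}$ (Dirichlet rectangles), $\mathfrak{T}=\{T_\alpha : 0<\alpha\le 1\}$ (separable flat two-dimensional tori) and $\mathfrak{K}=\{K_\alpha : \alpha\in\mathbb{R}_+\}$ (flat Klein bottles), the parameter $\alpha$ is uniquely determined by the nodal sequence. That is: (i) if $0<\alpha,\alpha'\le 1$ and $\mathfrak{N}(R_\alpha)=\mathfrak{N}(R_{\alpha'})$, then $\alpha=\alpha'$; (ii) if $0<\alpha,\alpha'\le 1$ and $\mathfrak{N}(T_\alpha)=\mathfrak{N}(T_{\alpha'})$, then $\alpha=\alpha'$; (iii) if $\alpha,\alpha'>0$ and $\mathfrak{N}(K_\alpha)=\mathfrak{N}(K_{\alpha'})$, then $\alpha=\alpha'$. Moreover, in each of the three classes there exists an explicit method which reconstructs $\alpha$ from the nodal sequence.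
   Context: All manifolds carry the Euclidean (flat) metric, and $\triangle$ is the (positive) Laplacian. $\mathbb{R}_+$ denotes the positive reals. For an eigenfunction $\Psi$ on $M$, its nodal domains are the connected components of $M\setminus\Psi^{-1}(0)$ and $\nu(\Psi)$ is their number. $\delta_{ij}$ is the Kronecker delta. **Rectangles.** For $0<\alpha\le 1$, $R_\alpha=[0,a]\times[0,b]$ with $a=1$, $b=1/\alpha$, with Dirichlet boundary conditions. The eigenfunctions considered are $\varphi_{mn}(x,y)=\sin(\pi m x/a)\sin(\pi n y/b)$, indexed by integers $m,n\ge 1$, with eigenvalues $\lambda_{mn}=\pi^2(m^2+\alpha^2n^2)$ and numbers of nodal domains $\nu_{mn}=mn$. **Separable tori.** For $0<\alpha\le 1$, $T_\alpha=\mathbb{R}^2/(a\mathbb{Z}\times b\mathbb{Z})$ with $a=1$, $b=1/\alpha$. The eigenfunctions considered are indexed by $(m,n)\in\mathbb{Z}^2$: $\varphi_{mn}(x,y)=f_m(2\pi m x/a)\,f_n(2\pi n y/b)$, where $f_k=\cos$ if $k\ge 0$ and $f_k=\sin$ if $k<0$. The eigenvalues are $\lambda_{mn}=4\pi^2(m^2+\alpha^2n^2)$ and the numbers of nodal domains are $\nu_{mn}=(2|m|+\delta_{m0})(2|n|+\delta_{n0})$. **Klein bottles.** For $\alpha>0$, let $a=1$, $b=1/\alpha$ and let $K_\alpha$ be the quotient of $\mathbb{R}^2$ by the group generated by $(x,y)\mapsto(x,y+b)$ and $(x,y)\mapsto(x+a/2,-y)$. The eigenfunctions considered are indexed by pairs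 $(m,n)\in\mathbb{Z}^2$ that are admissible, meaning ($m$ even and $n\ge 0$) or ($m$ odd and $n\ne 0$): $\Psi_{mn}(x,y)=\cos(2\pi m x/a)\cos(2\pi n y/b)$ for $m$ even, $n\ge0$, and $\Psi_{mn}(x,y)=\cos(2\pi m x/a)\sin(2\pi n y/b)$ for $m$ odd, $n\neq 0$. The eigenvalues are $\lambda_{mn}=4\pi^2(m^2+\alpha^2n^2)$ and the numbers of nodal domains are $\nu_{mn}=2|mn|+\delta_{m0}(|n|+1)+|m|\delta_{n0}$. **Nodal sequence.** In each case, for an eigenvalue $\lambda$ put $\mathcal{N}(\lambda)=\{\nu_{mn} : \lambda_{mn}=\lambda\}$ (a set of natural numbers, $(m,n)$ ranging over the indices listed above). Let $0<\lambda_1<\lambda_2<\cdots$ be the distinct positive eigenvalues. The nodal sequence of $M$ is the ordered sequence of sets $\mathfrak{N}(M)=(\mathcal{N}(\lambda_1),\mathcal{N}(\lambda_2),\dots)$; it does not contain the numerical values of the eigenvalues. A method which reconstructs $\alpha$ means a procedure whose only input is the nodal sequence (together with the knowledge of which of the three classes it comes from) and which yields $\alpha$, possibly as the limit of a constructed sequence. *)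

(* Defs.v *)
From HB Require Import structures.
From Stdlib Require Import Relation_Operators.
From Stdlib Require List.
From mathcomp Require Import all_boot all_order all_algebra.
From mathcomp Require Import all_classical all_reals all_analysis.

Set Implicit Arguments.
Unset Strict Implicit.
Unset Printing Implicit Defensive.

Import Order.TTheory GRing.Theory Num.Theory.
Import numFieldNormedType.Exports.

Local Open Scope classical_set_scope.
Local Open Scope quotient_scope.
Local Open Scope ring_scope.

(* A flat surface (the subset [pts] of [space]) together with the family of
   eigenfunctions under consideration.  [chart] is the local isometry from the
   Euclidean plane that supplies the flat coordinates. *)
Record surface (R : realType) := Surface {
  space : topologicalType;
  pts : set space;
  chart : R * R -> space;
  admissible : int -> int -> Prop;
  eigfun : int -> int -> space -> R
}.

Arguments pts {R} s _.
Arguments eigfun {R} s m n _ : rename.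

Section NodalSequence.
Variables (R : realType) (M : surface R).
Implicit Types (f : space M -> R) (lambda mu : R).

(* The positive Laplacian - (d^2/dx^2 + d^2/dy^2), computed in the chart. *)
Definition laplacian f (p : R * R) : R :=
  - (derive1n 2 (fun t => f (chart M (t, p.2))) p.1 +
     derive1n 2 (fun t => f (chart M (p.1, t))) p.2).

Definition eigenpair f lambda : Prop :=
  (exists2 x, pts M x & f x != 0) /\
  forall p, (chart M @^-1` pts M)° p ->
    laplacian f p = lambda * f (chart M p).

Definition off_nodal_set f : set (space M) := [set x | pts M x /\ f x != 0].

Definition nodal_domains f : set (set (space M)) :=
  [set connected_component (off_nodal_set f) x | x in off_nodal_set f].

Definition nodal_count f (v : nat) : Prop := (nodal_domains f #= `I_v)%card.

Definition nodal_counts lambda : set nat :=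
  [set v | exists m n : int, [/\ admissible M m n, eigenpair (eigfun M m n) lambda
                               & nodal_count (eigfun M m n) v]].

Definition positive_eigenvalues : set R :=
  [set lambda | 0 < lambda /\
     exists m n : int, admissible M m n /\ eigenpair (eigfun M m n) lambda].

(* [lambda] is the eigenvalue written lambda_(k+1) when the distinct positive
   eigenvalues are listed increasingly as lambda_1 < lambda_2 < ... *)
Definition kth_eigenvalue (k : nat) lambda : Prop :=
  positive_eigenvalues lambda /\
  ([set mu | positive_eigenvalues mu /\ (mu < lambda)%R] #= `I_k)%card.

Definition nodal_sequence (k : nat) : set nat :=
  [set v | exists lambda, kth_eigenvalue k lambda /\ nodal_counts lambda v].

End NodalSequence.

Section PlaneQuotient.
Variables (R : realType) (g1 g2 : R * R -> R * R).

(* For bijective g1 and g2, the equivalence relation generated by p ~ g1 p and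
   p ~ g2 p is the orbit relation of the group generated by g1 and g2. *)
Definition same_orbit : rel (R * R) := fun p q =>
  `[< clos_refl_sym_trans (R * R) (fun u v => v = g1 u \/ v = g2 u) p q >].

Lemma same_orbit_refl : reflexive same_orbit.
Proof. by move=> p; apply/asboolP; apply: rst_refl. Qed.

Lemma same_orbit_sym : symmetric same_orbit.
Proof. by move=> p q; apply/asboolP/asboolP; apply: rst_sym. Qed.

Lemma same_orbit_trans : transitive same_orbit.
Proof.
move=> q p r /asboolP pq /asboolP qr.
by apply/asboolP; apply: rst_trans pq qr.
Qed.

Canonical same_orbit_equiv :=
  EquivRel same_orbit same_orbit_refl same_orbit_sym same_orbit_trans.

Definition plane_quotient : topologicalType :=
  quotient_topology {eq_quot same_orbit_equiv}.

Definition plane_proj (p : R * R) : plane_quotient :=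
  \pi_(quotient_topology {eq_quot same_orbit_equiv}) p.

(* Every [phi] used below is invariant under g1 and g2, so the choice of
   representative is immaterial. *)
Definition descend (phi : R * R -> R) (x : plane_quotient) : R :=
  phi (repr (x : quotient_topology {eq_quot same_orbit_equiv})).

Definition quotient_surface (adm : int -> int -> Prop)
    (phi : int -> int -> R * R -> R) : surface R :=
  @Surface R plane_quotient setT plane_proj adm (fun m n => descend (phi m n)).

End PlaneQuotient.

Section Classes.
Variable R : realType.
Implicit Type alpha : R.

Definition rectangle alpha : surface R :=
  let b := alpha^-1 in
  @Surface R (R * R)%type
    [set p | 0 <= p.1 <= 1 /\ 0 <= p.2 <= b]
    id
    (fun m n => 1 <= m /\ 1 <= n)
    (fun m n p => sin (pi * m%:~R * p.1) * sin (pi * n%:~R * p.2 / b)).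

Definition trig (k : int) (t : R) : R := if 0 <= k then cos t else sin t.

Definition torus alpha : surface R :=
  let b := alpha^-1 in
  quotient_surface
    (fun p => (p.1 + 1, p.2)) (fun p => (p.1, p.2 + b))
    (fun _ _ => True)
    (fun m n p => trig m (2 * pi * m%:~R * p.1) *
                  trig n (2 * pi * n%:~R * p.2 / b)).

Definition klein_bottle alpha : surface R :=
  let b := alpha^-1 in
  quotient_surface
    (fun p => (p.1, p.2 + b)) (fun p => (p.1 + 2^-1, - p.2))
    (fun m n => if odd `|m|%N then n <> 0 else 0 <= n)
    (fun m n p =>
       cos (2 * pi * m%:~R * p.1) *
       (if odd `|m|%N then sin (2 * pi * n%:~R * p.2 / b)
        else cos (2 * pi * n%:~R * p.2 / b))).

End Classes.

(* Kleene's partial recursive functions relative to an oracle, which answers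
   the question whether v belongs to the k-th set of a sequence of sets of
   naturals.  Missing arguments are read as 0. *)
Inductive program :=
| Zero
| Succ
| Arg of nat
| Comp of program & seq program
| PrimRec of program & program
| Mu of program
| Query.

Inductive run (S : nat -> set nat) : program -> seq nat -> nat -> Prop :=
| run_zero xs : run S Zero xs 0%N
| run_succ xs : run S Succ xs (nth 0%N xs 0).+1
| run_arg i xs : run S (Arg i) xs (nth 0%N xs i)
| run_comp f gs xs ys y :
    List.Forall2 (fun g z => run S g xs z) gs ys -> run S f ys y ->
    run S (Comp f gs) xs y
| run_rec0 f g xs y : run S f xs y -> run S (PrimRec f g) (0%N :: xs) y
| run_recS f g n xs r y :
    run S (PrimRec f g) (n :: xs) r -> run S g [:: n, r & xs] y ->
    run S (PrimRec f g) (n.+1 :: xs) y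
| run_mu f xs n (t : nat -> nat) :
    (forall i, (i < n)%N -> run S f (i :: xs) (t i).+1) ->
    run S f (n :: xs) 0%N -> run S (Mu f) xs n
| run_query xs :
    run S Query xs (nat_of_bool `[< S (nth 0%N xs 0) (nth 0%N xs 1) >]).

(* A fixed pair of programs (for numerators and denominators) which, with the
   nodal sequence as sole input, generates rational approximations converging
   to the parameter. *)
Definition reconstructible (R : realType) (D : set R) (M : R -> surface R) :
    Prop :=
  exists num den : program, forall alpha, D alpha ->
    exists p q : nat -> nat,
      [/\ forall k, run (nodal_sequence (M alpha)) num [:: k] (p k),
          forall k, run (nodal_sequence (M alpha)) den [:: k] (q k),
          forall k, (0 < q k)%N
        & ((p k)%:R / (q k)%:R : R) @[k --> \oo] --> alpha].

(* Main.v *)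
From Stdlib Require Import Relation_Operators.
From mathcomp Require Import all_boot all_order all_algebra.
From mathcomp Require Import all_classical all_reals all_analysis.
From mathcomp Require Import zify ring lra.
Require Import Defs.

Set Implicit Arguments.
Unset Strict Implicit.
Unset Printing Implicit Defensive.

Import Order.TTheory GRing.Theory Num.Theory.
Import numFieldNormedType.Exports.

Local Open Scope classical_set_scope.
Local Open Scope ring_scope.

(** The eigenvalues are [c * (m ^ 2 + alpha ^ 2 * n ^ 2)], and the nodal
    sequence shows them only through their order.  The idea is to find two
    families of eigenfunctions that are recognisable by their nodal counts
    alone, and to read off [alpha] from the way in which the two families
    interleave.

    Rectangles.  A prime count [p] is attained exactly by [(1, p)] and
    [(p, 1)], and since [alpha <= 1] the smaller of the two energies is
    [1 + alpha ^ 2 * p ^ 2].  The largest energy at which a count [i] is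
    attained is that of [(i, 1)], namely [i ^ 2 + alpha ^ 2].  Hence [i] is
    absent from all sets after the first one containing [p] exactly when
    [i ^ 2 + alpha ^ 2 <= 1 + alpha ^ 2 * p ^ 2], that is, up to a bounded
    error, when [i <= alpha * p].  The number of such [i < p], divided by [p],
    tends to [alpha] ([rectangle_count_bounds]).

    Tori.  A count [4 * i + 2] is twice an odd number, which forces one of the
    two indices to vanish; the energies are [(2 * i + 1) ^ 2] and
    [alpha ^ 2 * (2 * i + 1) ^ 2], and the same comparison works for every [p]
    ([torus_count_bounds]).

    Klein bottles.  An odd count [2 * i + 3] is attained only by functions of
    [y], at the energy [(alpha * (2 * i + 2)) ^ 2]; these positions form a
    ruler with step proportional to [alpha].  For a prime [w] the energies
    with count [2 * w] stretch, up to lower order terms, from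
    [(min alpha 1 * w) ^ 2] to [(2 * max alpha 1 * w) ^ 2].  Measuring both
    ends with the ruler gives [min alpha 1 / (2 * alpha)] and
    [max alpha 1 / alpha] in the limit, and their product is
    [1 / (2 * alpha)] ([klein_count_first_bounds],
    [klein_count_last_bounds]).

    Only [O (w ^ 2)] eigenvalues lie below a bound of order [w ^ 2], so for
    large [w] it suffices to inspect the first [w ^ 3] sets.  The approximants
    are therefore bounded searches, expressible in a small language of bounded
    arithmetic that compiles to oracle programs.  As they are functions of the
    nodal sequence alone, uniqueness of limits also yields that the sequence
    determines [alpha] ([reconstructible_by]).

    The nodal counts themselves come from one principle.  The zero set of each
    eigenfunction is a grid of horizontal and vertical lines, so its
    complement in the plane is a disjoint union of open rectangular cells.
    Label every cell so that cells in one orbit of the group get the same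
    label; if conversely cells with the same label lie in one orbit, the nodal
    domains are the fibres of the label ([nodal_count_label],
    [nodal_count_grid]), and it remains to count labels. *)

(** * Oracle programs for bounded arithmetic *)

(** A query language just rich enough for the bounded searches below: [Occurs]
    consults the oracle, and [Sum], which binds the variable [0], serves as
    bounded quantifier. *)
Inductive term :=
| Var of nat
| Cst of nat
| Add of term & term
| Mul of term & term
| Monus of term & term
| IsZero of term
| Occurs of term & term
| Sum of term & term.

Fixpoint eval (S : nat -> set nat) (e : term) (xs : seq nat) : nat :=
  match e with
  | Var i => nth 0%N xs i
  | Cst n => n
  | Add a b => (eval S a xs + eval S b xs)%N
  | Mul a b => (eval S a xs * eval S b xs)%N
  | Monus a b => (eval S a xs - eval S b xs)%N
  | IsZero a => nat_of_bool (eval S a xs == 0)%N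
  | Occurs a b => nat_of_bool `[< S (eval S a xs) (eval S b xs) >]
  | Sum a b => (\sum_(i < eval S a xs) eval S b (nat_of_ord i :: xs))%N
  end.

Fixpoint cst_prog (n : nat) : program :=
  if n is n'.+1 then Comp Succ [:: cst_prog n'] else Zero.

Definition add_prog := PrimRec (Arg 0) (Comp Succ [:: Arg 1]).
Definition mul_prog := PrimRec Zero (Comp add_prog [:: Arg 1; Arg 2]).
Definition pred_prog := PrimRec Zero (Arg 0).
Definition sub_prog := PrimRec (Arg 0) (Comp pred_prog [:: Arg 1]).
Definition is_zero_prog := PrimRec (cst_prog 1) Zero.

(** Programs have no variables of their own, so that an environment must be
    copied argument by argument; [d] is its length.  The recursion behind
    [Sum] sees the index, the partial sum and the environment, and drops the
    partial sum before calling the summand. *)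
Fixpoint compile (d : nat) (e : term) : program :=
  match e with
  | Var i => Arg i
  | Cst n => cst_prog n
  | Add a b => Comp add_prog [:: compile d a; compile d b]
  | Mul a b => Comp mul_prog [:: compile d a; compile d b]
  | Monus a b => Comp sub_prog [:: compile d b; compile d a]
  | IsZero a => Comp is_zero_prog [:: compile d a]
  | Occurs a b => Comp Query [:: compile d a; compile d b]
  | Sum a b =>
    Comp (PrimRec Zero
            (Comp add_prog
               [:: Arg 1;
                   Comp (compile d.+1 b) (Arg 0 :: map Arg (iota 2 d))]))
         (compile d a :: map Arg (iota 0 d))
  end.

Section Compile.
Variable S : nat -> set nat.

Lemma run_comp1 f g xs y z :
  run S g xs y -> run S f [:: y] z -> run S (Comp f [:: g]) xs z.
Proof. by move=> gy; apply: run_comp; do !constructor. Qed.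

Lemma run_comp2 f g h xs y y' z : run S g xs y -> run S h xs y' ->
  run S f [:: y; y'] z -> run S (Comp f [:: g; h]) xs z.
Proof. by move=> gy hy; apply: run_comp; do !constructor. Qed.

Lemma run_cst n xs : run S (cst_prog n) xs n.
Proof.
elim: n => [|n ih] /=; first exact: run_zero.
by apply: run_comp1 ih _; apply: run_succ.
Qed.

Lemma run_add xs m n : run S add_prog [:: m, n & xs] (m + n)%N.
Proof.
elim: m => [|m ih]; first by apply: run_rec0; apply: (run_arg S 0 (n :: xs)).
apply: run_recS ih _; apply: run_comp1; first exact: run_arg.
exact: (run_succ S [:: _]).
Qed.

Lemma run_mul xs m n : run S mul_prog [:: m, n & xs] (m * n)%N.
Proof.
elim: m => [|m ih]; first by apply: run_rec0; apply: run_zero.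
apply: run_recS ih _; apply: run_comp2; [exact: run_arg|exact: run_arg|].
by rewrite /= mulSn addnC; apply: run_add.
Qed.

Lemma run_pred n xs : run S pred_prog (n :: xs) n.-1.
Proof.
elim: n => [|n ih]; first by apply: run_rec0; apply: run_zero.
by apply: run_recS ih _; apply: (run_arg S 0 (n :: _)).
Qed.

Lemma run_sub xs m n : run S sub_prog [:: m, n & xs] (n - m)%N.
Proof.
elim: m => [|m ih].
  by rewrite subn0; apply: run_rec0; apply: (run_arg S 0 (n :: xs)).
apply: run_recS ih _; apply: run_comp1; first exact: run_arg.
by rewrite /= subnS; apply: run_pred.
Qed.

Lemma run_is_zero n : run S is_zero_prog [:: n] (n == 0)%N.
Proof.
elim: n => [|n ih]; first by apply: run_rec0; apply: run_cst.
by apply: run_recS ih _; apply: run_zero.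
Qed.

Lemma run_args xs ys :
  List.Forall2 (fun g z => run S g (xs ++ ys) z)
    (map Arg (iota (size xs) (size ys))) ys.
Proof.
elim: ys xs => [|y ys ih] xs /=; first exact: List.Forall2_nil.
apply: List.Forall2_cons; last by rewrite -cat_rcons -(size_rcons xs y).
by have := run_arg S (size xs) (xs ++ y :: ys); rewrite nth_cat ltnn subnn.
Qed.

Lemma run_compile e xs : run S (compile (size xs) e) xs (eval S e xs).
Proof.
elim: e xs => [i|n|a iha b ihb|a iha b ihb|a iha b ihb|a iha|a iha b ihb
              |a iha b ihb] xs /=.
- exact: run_arg.
- exact: run_cst.
- exact: run_comp2 (iha _) (ihb _) (run_add _ _ _).
- exact: run_comp2 (iha _) (ihb _) (run_mul _ _ _).
- exact: run_comp2 (ihb _) (iha _) (run_sub _ _ _).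
- exact: run_comp1 (iha _) (run_is_zero _).
- exact: run_comp2 (iha _) (ihb _) (run_query S [:: _; _]).
apply: (run_comp (ys := eval S a xs :: xs)).
  by apply: List.Forall2_cons (iha xs) _; apply: (@run_args [::] xs).
elim: (eval S a xs) => [|n ih]; first by rewrite big_ord0;
  apply/run_rec0/run_zero.
apply: run_recS ih _; rewrite big_ord_recr /=; set r := (\sum_(_ < n) _)%N.
apply: run_comp2; first exact: (run_arg S 1 [:: n, r & xs]).
  apply: (run_comp (ys := n :: xs)) (ihb (n :: xs)).
  apply: List.Forall2_cons; first exact: (run_arg S 0 [:: n, r & xs]).
  exact: (@run_args [:: n; r] xs).
exact: run_add.
Qed.

End Compile.

(** * Ordering of the eigenvalues *)

(** The bound [K] turns the comparison of two counts into a finite search. *)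
Definition precedes (S : nat -> set nat) (K u v : nat) : Prop :=
  exists j k, [/\ (j < k)%N, (k < K)%N, S j u & S k v].

Definition energy (R : realType) (alpha : R) (m n : int) : R :=
  m%:~R ^+ 2 + alpha ^+ 2 * n%:~R ^+ 2.

(** What the reconstruction uses about a surface.  Nodal counts are asked for
    at positive energies only, as the constant functions do not enter the
    nodal sequence. *)
Definition has_nodal_data (R : realType) (M : surface R) (alpha c : R)
    (nu : int -> int -> nat) : Prop :=
  0 < c /\ forall m n, admissible M m n ->
    (forall lambda, eigenpair (eigfun M m n) lambda <->
                    lambda = c * energy alpha m n) /\
    (0 < energy alpha m n ->
     forall v, nodal_count (eigfun M m n) v <-> v = nu m n).

Lemma intr_sqr_abs (R : realType) (k : int) :
  (k%:~R : R) ^+ 2 = (`|k|%N)%:R ^+ 2.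
Proof. by case: k => n //; rewrite NegzE mulrNz sqrrN. Qed.
Section Rank.
Variables (R : realType) (M : surface R).

(** The eigenvalues below [lambda] form a strict subset of those below [mu],
    which contains [lambda] itself. *)
Lemma kth_eigenvalue_mono j k lambda mu :
  kth_eigenvalue M j lambda -> kth_eigenvalue M k mu -> lambda < mu ->
  (j < k)%N.
Proof.
move=> [posl cardj] [_ cardk] lt_lm.
have finj : finite_set [set x | positive_eigenvalues M x /\ x < lambda].
  by apply/finite_setP; exists j.
have fink : finite_set [set x | positive_eigenvalues M x /\ x < mu].
  by apply/finite_setP; exists k.
rewrite -(card_fset_set cardj) -(card_fset_set cardk).
apply: finmap.fproper_ltn_card; rewrite finmap.fproperE; apply/andP; split.
  apply/finmap.fsubsetP => x; rewrite !in_fset_set// !inE /= => -[px xl].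
  by split => //; exact: lt_trans lt_lm.
apply/finmap.fsubsetPn; exists lambda; rewrite in_fset_set//.
  by rewrite inE.
by apply/negP; rewrite inE /= ltxx => -[].
Qed.

Lemma kth_eigenvalue_lt j k lambda mu :
  kth_eigenvalue M j lambda -> kth_eigenvalue M k mu -> (j < k)%N ->
  lambda < mu.
Proof.
move=> kl km jk; case: ltgtP => // [ml|lm].
  by have := ltn_trans jk (kth_eigenvalue_mono km kl ml); rewrite ltnn.
have: (`I_j #= `I_k)%card.
  case: kl km => _ + [_]; rewrite lm => cj ck.
  by apply: (card_eq_trans _ ck); rewrite card_eq_sym.
by rewrite card_eq_le !card_le_II => /andP[_]; rewrite leqNgt jk.
Qed.

Variables (alpha c : R) (nu : int -> int -> nat).
Hypothesis alpha_gt0 : 0 < alpha.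
Hypothesis data : has_nodal_data M alpha c nu.

Lemma nodal_countsP lambda v : 0 < lambda -> nodal_counts M lambda v <->
  exists m n, [/\ admissible M m n, lambda = c * energy alpha m n & v = nu m n].
Proof.
case: data => c0 D l0; split => [[m [n [a e b]]]|[m [n [a e b]]]];
    exists m, n; have [D1 D2] := D m n a.
  move/D1: e => e; split => //; apply/D2 => //.
  by move: l0; rewrite e pmulr_rgt0.
split => //; first exact/D1.
by apply/D2 => //; move: l0; rewrite e pmulr_rgt0.
Qed.

Lemma positive_eigenvaluesP lambda : positive_eigenvalues M lambda <->
  0 < lambda /\ exists m n, admissible M m n /\ lambda = c * energy alpha m n.
Proof.
case: data => c0 D; split => -[l0 [m [n [a e]]]]; split => //; exists m, n;
  have [D1 D2] := D m n a; split => //; exact/D1.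
Qed.

Lemma precedesE K u v : precedes (nodal_sequence M) K u v ->
  exists m n m' n', [/\ admissible M m n /\ admissible M m' n', u = nu m n,
    v = nu m' n' & 0 < energy alpha m n < energy alpha m' n'].
Proof.
case: (data) => c0 _ [j [k [jk _ [lambda [kl Nl]] [mu [km Nm]]]]].
have lt_lm := kth_eigenvalue_lt kl km jk.
have l0 : 0 < lambda by case: kl => /positive_eigenvaluesP[].
move: Nl Nm => /(nodal_countsP _ l0)[m [n [a1 e1 v1]]].
move=> /(nodal_countsP _ (lt_trans l0 lt_lm))[m' [n' [a2 e2 v2]]].
exists m, n, m', n'; split => //; apply/andP; split.
  by move: l0; rewrite e1 pmulr_rgt0.
by move: lt_lm; rewrite e1 e2 ltr_pM2l.
Qed.

(** Indices of energy at most [A ^ 2] satisfy [`|m| <= A] and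
    [`|n| <= A / alpha <= A * B], which leaves finitely many smaller
    eigenvalues and bounds their number. *)
Lemma kth_eigenvalue_exists (A B : nat) m n : admissible M m n ->
  0 < energy alpha m n <= A%:R ^+ 2 -> alpha^-1 <= B%:R ->
  exists k, (k <= A.+1 * (A * B).+1)%N /\
            kth_eigenvalue M k (c * energy alpha m n).
Proof.
move=> a /andP[e0 eA] aB; case: (data) => c0 _.
have A0 : 0 < (A%:R : R) ^+ 2 by exact: lt_le_trans eA.
have l0 : 0 < c * energy alpha m n by rewrite pmulr_rgt0.
set E := [set mu | positive_eigenvalues M mu /\ mu < c * energy alpha m n].
set N := (A.+1 * (A * B).+1)%N.
pose f (t : nat) : R :=
  c * energy alpha (t %/ (A * B).+1)%N (t %% (A * B).+1)%N.
have natsqr (x y : nat) : (x%:R : R) ^+ 2 <= y%:R ^+ 2 -> (x <= y)%N.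
  by rewrite ler_pXn2r ?nnegrE ?ler0n// ler_nat.
have sub : E `<=` f @` `I_N.
  move=> mu [/positive_eigenvaluesP[_ [m' [n' [_ ->]]]]];
    rewrite ltr_pM2l// => lt.
  have le2 : energy alpha m' n' <= A%:R ^+ 2 by rewrite (le_trans (ltW lt)).
  have mA : (`|m'| <= A)%N.
    apply: natsqr; rewrite -intr_sqr_abs; apply: le_trans le2.
    by rewrite /energy lerDl mulr_ge0 ?sqr_ge0.
  have nA : (`|n'| <= A * B)%N.
    apply: natsqr; rewrite -intr_sqr_abs natrM exprMn.
    have : alpha ^+ 2 * n'%:~R ^+ 2 <= A%:R ^+ 2.
      by apply: le_trans le2; rewrite /energy lerDr sqr_ge0.
    rewrite mulrC -ler_pdivlMr ?exprn_gt0// => /le_trans; apply.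
    rewrite ler_pM2l//.
    by rewrite -exprVn ler_pXn2r ?nnegrE ?invr_ge0 ?ler0n // ltW.
  exists (`|m'| * (A * B).+1 + `|n'|)%N.
    rewrite /= /N; nia.
  rewrite /f divnMDl// divn_small ?ltnS// addn0 modnMDl modn_small ?ltnS//.
  by rewrite /energy !intr_sqr_abs.
have finE : finite_set E
  by exact: sub_finite_set sub (finite_image _ (finite_II _)).
have /finite_setP[k cardk] := finE.
exists k; split.
  rewrite -card_le_II; apply: card_le_trans (card_image_le f _).
  by apply: card_le_trans (subset_card_le sub); move: cardk;
    rewrite card_eq_le => /andP[].
by split => //; apply/positive_eigenvaluesP; split => //; exists m, n.
Qed.

Lemma precedesI (A B K : nat) m n m' n' :
  admissible M m n -> admissible M m' n' ->
  0 < energy alpha m n < energy alpha m' n' ->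
  energy alpha m' n' <= A%:R ^+ 2 -> alpha^-1 <= B%:R ->
  (A.+1 * (A * B).+1 < K)%N ->
  precedes (nodal_sequence M) K (nu m n) (nu m' n').
Proof.
case: (data) => c0 D a a' /andP[e0 ee] eA aB AK; have e'0 := lt_trans e0 ee.
have [k' [k'K kth']] : exists k, (k <= A.+1 * (A * B).+1)%N /\
    kth_eigenvalue M k (c * energy alpha m' n').
  by apply: kth_eigenvalue_exists => //; rewrite e'0.
have [k [kK kth]] : exists k, (k <= A.+1 * (A * B).+1)%N /\
    kth_eigenvalue M k (c * energy alpha m n).
  by apply: kth_eigenvalue_exists => //; rewrite e0 (le_trans (ltW ee)).
exists k, k'; split.
- by apply: kth_eigenvalue_mono kth kth' _; rewrite ltr_pM2l.
- exact: leq_ltn_trans k'K AK.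
- exists (c * energy alpha m n); split => //.
  by apply/nodal_countsP; [rewrite pmulr_rgt0|exists m, n].
- exists (c * energy alpha m' n'); split => //.
  by apply/nodal_countsP; [rewrite pmulr_rgt0|exists m', n'].
Qed.

End Rank.

(** * Density of bounded counts *)

Section Counting.
Variable R : realType.

Definition count_below (P : nat -> Prop) (N : nat) : nat :=
  (\sum_(i < N) nat_of_bool `[< P i >])%N.

(** Counting [0], there are [floor x + 1] naturals up to [x]; so nothing is
    lost in the lower bound, while the upper bound below exceeds [y] by one. *)
Lemma count_below_ge (P : nat -> Prop) N (x : R) :
  (forall i, (i < N)%N -> i%:R <= x -> P i) -> x <= N%:R ->
  x <= (count_below P N)%:R.
Proof.
move=> Px xN; suff: Num.min x N%:R <= (count_below P N)%:R by rewrite min_l.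
elim: N Px {xN} => [|N ih] Px; first
  by rewrite /count_below big_ord0 ge_min lexx orbT.
have {}ih := ih (fun i iN => Px i (ltnW iN)).
rewrite /count_below big_ord_recr natrD /= -/(count_below P N) ge_min.
have [Nx|xN] := leP N%:R x.
  have -> : `[< P N >] by apply/asboolP/Px.
  move: ih; rewrite min_r// => ih.
  by apply/orP; right; rewrite -(natr1 N) lerD2r.
move: ih; rewrite (min_l (ltW xN)) => ih.
by rewrite (le_trans ih)// lerDl ler0n.
Qed.

Lemma count_below_le (P : nat -> Prop) N (y : R) : -1 <= y ->
  (forall i, (i < N)%N -> P i -> i%:R <= y) -> (count_below P N)%:R <= y + 1.
Proof.
move=> y0; elim: N => [|N ih] Py.
  by rewrite /count_below big_ord0 -lerBlDr sub0r.
have {}ih := ih (fun i iN => Py i (ltnW iN)).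
rewrite /count_below big_ord_recr natrD /= -/(count_below P N).
case: asboolP => [PN|_]; last by rewrite addr0.
rewrite lerD2r; apply: le_trans (Py N (ltnSn N) PN); rewrite ler_nat.
rewrite /count_below -[leqRHS]card_ord -sum1_card; apply: leq_sum => i _.
exact: leq_b1.
Qed.

(** A bounded error disappears after division by [w k]. *)
Lemma ratio_cvg (u w : nat -> nat) (l C : R) :
  w k @[k --> \oo] --> \oo ->
  (\forall k \near \oo, `|(u k)%:R - l * (w k)%:R| <= C) ->
  ((u k)%:R / (w k)%:R : R) @[k --> \oo] --> l.
Proof.
move=> /cvgnyPge winf close; apply/cvgrPdist_le => e e0.
set D := Num.bound (`|C| / e).
have CD : `|C| / e < D%:R by apply: archi_boundP; rewrite divr_ge0// ltW.
near=> k.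
have Dw : (D.+1 <= w k)%N by near: k; exact: winf.
have w0 : 0 < (w k)%:R :> R by rewrite ltr0n (leq_trans _ Dw).
rewrite distrC -{1}(mulfK (lt0r_neq0 w0) l) -mulrBl normrM normfV.
rewrite (gtr0_norm w0) ler_pdivrMr//.
have : `|(u k)%:R - l * (w k)%:R| <= C by near: k.
move=> /le_trans; apply; rewrite (le_trans (ler_norm C))//.
rewrite mulrC -ler_pdivrMr// (le_trans (ltW CD))// ler_nat.
exact: ltnW.
Unshelve. all: by end_near. Qed.

End Counting.

(** * Recognisable eigenvalues and their comparison *)

Lemma prime_factors p a b : prime p -> (a * b)%N = p ->
  a = 1%N /\ b = p \/ a = p /\ b = 1%N.
Proof.
move=> pp abp; have p1 := prime_gt1 pp; have /primeP[_ dv] := pp.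
have /dv/orP[/eqP a1|/eqP ap] : (a %| p)%N by rewrite -abp dvdn_mulr.
  by left; split => //; rewrite -abp a1 mul1n.
right; split => //; apply/eqP; rewrite -(@eqn_pmul2l p) ?prime_gt0//.
by rewrite muln1 -{1}ap abp.
Qed.

(** The left-hand side bounds the position of an eigenvalue of energy at most
    [(D * w) ^ 2] and grows like [w ^ 2]. *)
Lemma cube_exceeds_box D B w : (0 < D)%N -> (0 < B)%N ->
  (4 * D ^ 2 * B < w)%N ->
  ((D * w).+1 * (D * w * B).+1 < w ^ 3)%N.
Proof.
move=> D0 B0 lt; have w0 : (0 < w)%N by lia.
have h1 : ((D * w).+1 <= 2 * (D * w))%N.
  have : (0 < D * w)%N by rewrite muln_gt0 D0.
  by lia.
have h2 : ((D * w * B).+1 <= 2 * (D * w * B))%N.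
  have : (0 < D * w * B)%N by rewrite !muln_gt0 D0 w0.
  by lia.
apply: (leq_ltn_trans (leq_mul h1 h2)).
have -> : (2 * (D * w) * (2 * (D * w * B)) = (4 * D ^ 2 * B) * w ^ 2)%N.
  by rewrite !expnS !expn0; nia.
by rewrite (expnS w 2) ltn_pmul2r ?expn_gt0 ?w0.
Qed.

(** Essentially the number of [i] with [(i, 1)] not above [(1, p)] in energy,
    for prime [p]. *)
Definition rectangle_count (S : nat -> set nat) p :=
  count_below (fun i => ~ precedes S (p ^ 3) p i) p.

(** Essentially the number of [i] with [(2 * i + 1, 0)] not above
    [(0, 2 * p + 1)] in energy. *)
Definition torus_count (S : nat -> set nat) p :=
  count_below (fun i => ~ precedes S (p ^ 3) (4 * p + 2)%N (4 * i + 2)%N) p.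

(** The first occurrence of the count [2 * w], measured by the functions of
    [y] alone, whose counts are odd. *)
Definition klein_count_first (S : nat -> set nat) w :=
  count_below (fun i => ~ precedes S (w ^ 3) (2 * w)%N (2 * i + 3)%N) w.

(** The last occurrence of the count [2 * w].  The range [w ^ 2] exceeds the
    number of odd counts to be seen, which is about [max alpha 1 / alpha * w],
    for all large [w]. *)
Definition klein_count_last (S : nat -> set nat) w :=
  count_below (fun i => precedes S (w ^ 3) (2 * i + 3)%N (2 * w)%N) (w ^ 2).

Lemma inv_bound_gt0 (R : realType) (alpha : R) (B : nat) : 0 < alpha ->
  alpha^-1 <= B%:R -> (0 < B)%N.
Proof.
by move=> a0; rewrite -(ltr0n R); apply: lt_le_trans; rewrite invr_gt0.
Qed.

Section Methods.
Variables (R : realType) (M : surface R) (alpha c : R) (nu : int -> int -> nat).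
Hypothesis alpha_gt0 : 0 < alpha.
Hypothesis data : has_nodal_data M alpha c nu.
Variable B : nat.
Hypothesis alphaB : alpha^-1 <= B%:R.

Local Notation S := (nodal_sequence M).

(** For [a, b >= 1] the factorisations of [i = a * b] satisfy
    [a ^ 2 + alpha ^ 2 * b ^ 2 <= i ^ 2 + alpha ^ 2], because the difference
    is [(a ^ 2 - alpha ^ 2) * (b ^ 2 - 1)]; so the last occurrence of [i] is
    [(i, 1)].  The first occurrence of [p] is [(1, p)]. *)
Lemma rectangle_count_bounds p : alpha <= 1 ->
  (forall m n, admissible M m n <-> 1 <= m /\ 1 <= n) ->
  (forall m n, nu m n = `|m| * `|n|)%N ->
  prime p -> (16 * B < p)%N ->
  `|(rectangle_count S p)%:R - alpha * p%:R| <= 2.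
Proof.
move=> a1 adm nuE pp pB; have al0 := alpha_gt0.
have p0 : 0 < p%:R :> R by rewrite ltr0n prime_gt0.
have p1 : 1 <= p%:R :> R by rewrite ler1n prime_gt0.
have posE m n : admissible M m n -> exists x y : nat,
    [/\ m = x.+1, n = y.+1 & nu m n = x.+1 * y.+1]%N.
  move: m n => [[|x]|x] [[|y]|y] /adm[] // _ _.
  by exists x, y; rewrite nuE.
have lower : alpha * p%:R <= (rectangle_count S p)%:R.
  apply: count_below_ge => [i ip iap|]; last by rewrite ler_piMl ?ler0n.
  case/(precedesE data) => m [n [m' [n' [[mn mn'] pE iE lt]]]].
  move: pE iE lt; have [x [y [-> -> ->]]] := posE _ _ mn.
  have [x' [y' [-> -> ->]]] := posE _ _ mn' => pE iE /andP[_].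
  apply/negP; rewrite -leNgt /energy -!pmulrn.
  apply: (@le_trans _ _ (i%:R ^+ 2 + alpha ^+ 2)).
    rewrite iE natrM.
    have : 1 <= x'.+1%:R :> R by rewrite ler1n.
    have : 1 <= y'.+1%:R :> R by rewrite ler1n.
    move: (x'.+1%:R : R) (y'.+1%:R : R) => X Y Y1 X1.
    have X2 : 0 <= X ^+ 2 - alpha ^+ 2.
      by rewrite subr_ge0 ler_pXn2r ?nnegrE//; lra.
    have Y2 : 0 <= Y ^+ 2 - 1 by rewrite subr_ge0 exprn_ege1.
    by have := mulr_ge0 X2 Y2; nra.
  have : 1 + alpha ^+ 2 * p%:R ^+ 2 <= x.+1%:R ^+ 2 +
    alpha ^+ 2 * y.+1%:R ^+ 2 :> R.
    have a1p1 : 0 <= (1 - alpha ^+ 2) * (p%:R ^+ 2 - 1) :> R.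
      by apply: mulr_ge0; nra.
    by case: (prime_factors pp (esym pE)) => -[-> ->]; nra.
  apply: le_trans; have : i%:R ^+ 2 <= (alpha * p%:R) ^+ 2.
    by rewrite ler_pXn2r ?nnegrE ?ler0n// mulr_ge0// ltW.
  by nra.
have upper : (rectangle_count S p)%:R <= alpha * p%:R + 1 + 1.
  apply: count_below_le => [|i ip]; first by nra.
  apply: contra_notP => /negP; rewrite -ltNge => lti.
  have i0 : (0 < i)%N by rewrite -(ltr0n R); nra.
  have lt_sqr : (alpha * p%:R + 1) ^+ 2 < (i%:R) ^+ 2 :> R.
    by rewrite ltr_pXn2r ?nnegrE//; nra.
  (* The energies compared are at most (2 * p) ^ 2, whence the factor
     16 = 4 * 2 ^ 2 in the bound on p. *)
  suff: precedes S (p ^ 3) (nu 1 p) (nu i 1)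
    by rewrite !nuE !absz_nat mul1n muln1.
  apply: (precedesI alpha_gt0 data (A := (2 * p)%N) (B := B)).
  - by apply/adm; lia.
  - by apply/adm; lia.
  - rewrite /energy -!pmulrn expr1n mulr1; apply/andP; split; nra.
  - have : i%:R <= p%:R :> R by rewrite ler_nat ltnW.
    by rewrite /energy -!pmulrn natrM; have := ler0n R i; nra.
  - exact: alphaB.
  - exact: cube_exceeds_box (ltn0Sn 1) (inv_bound_gt0 alpha_gt0 alphaB) pB.
by rewrite ler_norml; lra.
Qed.

(** As [alpha <= 1], the count [4 * i + 2] occurs first on the [y]-axis of
    indices and last on the [x]-axis. *)
Lemma torus_count_bounds p : alpha <= 1 ->
  (forall m n, admissible M m n) ->
  (forall m n, nu m n = (2 * `|m| + (m == 0)) * (2 * `|n| + (n == 0)))%N ->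
  (16 * B < p)%N ->
  `|(torus_count S p)%:R - alpha * p%:R| <= 1.
Proof.
move=> a1 adm nuE pB; have al0 := alpha_gt0.
have p1 : 1 <= p%:R :> R by rewrite ler1n; lia.
(* Off the axes both factors of the count are even, so 4 divides it. *)
have axis m n (i : nat) : nu m n = (4 * i + 2)%N ->
    energy alpha m n = (2 * i%:R + 1) ^+ 2 \/
    energy alpha m n = alpha ^+ 2 * (2 * i%:R + 1) ^+ 2.
  have odd_sqr k : `|k|%N = (2 * i + 1)%N ->
    (k%:~R : R) ^+ 2 = (2 * i%:R + 1) ^+ 2.
    by move=> kE; rewrite intr_sqr_abs kE natrD natrM.
  rewrite nuE /energy; have [->|m0] := eqVneq m 0.
    have [->|n0] := eqVneq n 0; first by rewrite /=; lia.
    move=> e; right; rewrite (odd_sqr n); last by move: e; rewrite /=; lia.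
    by rewrite expr0n add0r.
  have [->|n0] := eqVneq n 0.
    move=> e; left; rewrite (odd_sqr m); last by move: e; rewrite /=; lia.
    by rewrite expr0n mulr0 addr0.
  by move=> e; exfalso; move: e; nia.
have lower : alpha * p%:R - 2^-1 <= (torus_count S p)%:R.
  apply: count_below_ge => [i ip iap|]; last by nra.
  case/(precedesE data) => m [n [m' [n' [_ pE iE /andP[_]]]]].
  apply/negP; rewrite -leNgt.
  have : 0 <= i%:R :> R by [].
  set X := (i%:R : R) in iap *; set P := (p%:R : R) in p1 iap *.
  move=> X0; have le1 : (2 * X + 1) ^+ 2 <= alpha ^+ 2 * (2 * P + 1) ^+ 2.
    by rewrite -exprMn ler_pXn2r ?nnegrE//; nra.
  have a21 : alpha ^+ 2 <= 1 by rewrite expr_le1// ltW.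
  have sq0 (z : R) : 0 <= (1 - alpha ^+ 2) * (2 * z + 1) ^+ 2.
    by rewrite mulr_ge0 ?sqr_ge0// subr_ge0.
  have := sq0 X; have := sq0 P.
  by case: (axis _ _ _ (esym pE)) => ->; case: (axis _ _ _ (esym iE)) => ->;
    lra.
have upper : (torus_count S p)%:R <= alpha * p%:R + 1.
  apply: count_below_le => [|i ip]; first by nra.
  apply: contra_notP => /negP; rewrite -ltNge => lti.
  have i0 : (0 < i)%N by rewrite -(ltr0n R); nra.
  have lt_sqr : (alpha * (2 * p%:R + 1)) ^+ 2 < (2 * i%:R + 1) ^+ 2 :> R.
    by rewrite ltr_pXn2r ?nnegrE//; nra.
  suff: precedes S (p ^ 3) (nu 0 (2 * p + 1)%N) (nu (2 * i + 1)%N 0).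
    rewrite !nuE; congr precedes; lia.
  apply: (precedesI alpha_gt0 data (A := (2 * p)%N) (B := B)) => //.
  - rewrite /energy mulr0z expr0n /= -!pmulrn !natrD; apply/andP; split; nra.
  - have : i%:R + 1 <= p%:R :> R by rewrite natr1 ler_nat.
    rewrite /energy mulr0z expr0n /= -!pmulrn natrM !natrD.
    by have := ler0n R i; nra.
  - exact: cube_exceeds_box (ltn0Sn 1) (inv_bound_gt0 alpha_gt0 alphaB) pB.
by rewrite ler_norml; lra.
Qed.
End Methods.

Lemma sqr_mono (R : realType) (a b : R) : 0 <= a -> a <= b -> a ^+ 2 <= b ^+ 2.
Proof. by move=> a0 ab; rewrite ler_pXn2r ?nnegrE// (le_trans a0). Qed.

Section KleinMethod.
Variables (R : realType) (M : surface R) (alpha c : R) (nu : int -> int -> nat).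
Hypothesis alpha_gt0 : 0 < alpha.
Hypothesis data : has_nodal_data M alpha c nu.
Hypothesis adm : forall m n,
  admissible M m n <-> if odd `|m|%N then n <> 0 else 0 <= n.
Hypothesis nuE : forall m n, nu m n =
  (2 * (`|m| * `|n|) + (m == 0) * (`|n| + 1) + `|m| * (n == 0))%N.

Local Notation S := (nodal_sequence M).

(** All other counts are even: [2 * `|m * n|] off the axes, and [`|m|] for
    [n = 0], where only even [m] are admissible. *)
Lemma klein_odd_count m n i : admissible M m n -> nu m n = (2 * i + 3)%N ->
  energy alpha m n = (alpha * (2 * i%:R + 2)) ^+ 2.
Proof.
rewrite adm nuE /energy !intr_sqr_abs exprMn.
have [->|m0] := eqVneq m 0.
  rewrite /= => n0 e; have -> : `|n|%N = (2 * i + 2)%N.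
    by case: eqVneq e => /=; lia.
  by rewrite expr0n add0r natrD natrM.
have [->|n0] := eqVneq n 0; last by move=> _ e; exfalso; lia.
case: ifP => // modd _ e; exfalso; move: modd e.
by rewrite absz0; lia.
Qed.

(** The count [2 * w] comes from [`|n| = 2 * w - 1] on one axis,
    [`|m| = 2 * w] on the other, and from the two factorisations of the
    prime [w]. *)
Lemma klein_even_count m n w : prime w -> admissible M m n ->
  nu m n = (2 * w)%N ->
  (Num.min alpha 1 * w%:R) ^+ 2 <= energy alpha m n /\
  energy alpha m n <= (2 * Num.max alpha 1 * w%:R + (alpha + 1)) ^+ 2.
Proof.
move=> pw; rewrite adm nuE /energy !intr_sqr_abs => am e.
have al0 := alpha_gt0.
have w1 : 1 <= w%:R :> R by rewrite ler1n prime_gt0.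
set mn := Num.min alpha 1; set mx := Num.max alpha 1.
have mn1 : mn <= 1 by rewrite /mn ge_min lexx orbT.
have mna : mn <= alpha by rewrite /mn ge_min lexx.
have mn0 : 0 < mn by rewrite /mn lt_min alpha_gt0 ltr01.
have mx1 : 1 <= mx by rewrite /mx le_max lexx orbT.
have mxa : alpha <= mx by rewrite /mx le_max lexx.
move: mn mx mn1 mna mn0 mx1 mxa => mn mx mn1 mna mn0 mx1 mxa.
have w0 : 0 <= w%:R :> R by [].
have al2 := sqr_ge0 alpha.
have aw : alpha <= alpha * w%:R by rewrite ler_peMr// ltW.
have mnw0 : 0 <= mn * w%:R by rewrite mulr_ge0// ltW.
have mnw : mn * w%:R <= w%:R by rewrite ler_piMl.
have mnaw : mn * w%:R <= alpha * w%:R by rewrite ler_wpM2r.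
have mxw : w%:R <= mx * w%:R by rewrite ler_peMl.
have mxaw : alpha * w%:R <= mx * w%:R by rewrite ler_wpM2r.
move: e; have [m0|m0] := eqVneq m 0.
  rewrite m0 absz0 !(mul0n, muln0, add0n, addn0, mul1n) => e.
  have -> : `|n|%N = (2 * w - 1)%N by clear -e; lia.
  rewrite expr0n add0r -exprMn natrB ?natrM; last by have := prime_gt0 pw;
    clear; lia.
  by split; apply: sqr_mono; lra.
have [n0|n0] := eqVneq n 0.
  rewrite n0 absz0 !(mul0n, muln0, add0n, addn0, muln1) => e.
  rewrite e.
  by rewrite expr0n mulr0 addr0 natrM; split; apply: sqr_mono; lra.
rewrite mul0n muln0 !addn0 => /eqP.
rewrite eqn_pmul2l// => /eqP mnE.
have [[-> ->]|[-> ->]] := prime_factors pw mnE; split.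
- apply: (@le_trans _ _ ((alpha * w%:R) ^+ 2)); first by apply: sqr_mono; lra.
  by rewrite exprMn; lra.
- apply: (@le_trans _ _ ((alpha * w%:R + 1) ^+ 2)); first by lra.
  by apply: sqr_mono; lra.
- apply: (@le_trans _ _ (w%:R ^+ 2)); first by apply: sqr_mono; lra.
  by lra.
- apply: (@le_trans _ _ ((w%:R + alpha) ^+ 2)); first by lra.
  by apply: sqr_mono; lra.
Qed.

Variables B D : nat.
Hypothesis alphaB : alpha^-1 <= B%:R.
Hypothesis alphaD : 3 * (alpha + 1) <= D%:R.


Lemma D_pos : (0 < D)%N.
Proof. by rewrite -(ltr0n R); have al0 := alpha_gt0; have := alphaD; lra. Qed.

Lemma klein_odd_admissible i :
  admissible M 0 (2 * i + 2)%N /\ nu 0 (2 * i + 2)%N = (2 * i + 3)%N.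
Proof.
split; first by apply/adm.
by rewrite nuE absz0 !(mul0n, muln0, add0n, addn0, mul1n) absz_nat; lia.
Qed.

Lemma klein_odd_energy i :
  energy alpha 0 (2 * i + 2)%N = (alpha * (2 * i%:R + 2)) ^+ 2.
Proof. by have [a e] := klein_odd_admissible i; apply: klein_odd_count e. Qed.

(** The lower bound of [klein_even_count] is nearly attained, by [(1, w)] or
    by [(w, 1)] according to whether [alpha <= 1]. *)
Lemma klein_first_witness w : prime w -> exists m n,
  [/\ admissible M m n, nu m n = (2 * w)%N, 0 < energy alpha m n &
      energy alpha m n <= (Num.min alpha 1 * w%:R + (alpha + 1)) ^+ 2].
Proof.
move=> pw; have al0 := alpha_gt0; have w0 := prime_gt0 pw.
have w1 : 0 < w%:R :> R by rewrite ltr0n.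
have aw : 0 < alpha * w%:R by rewrite mulr_gt0.
have al2 := sqr_ge0 alpha.
have aw2 : 0 < alpha ^+ 2 * w%:R ^+ 2 by rewrite -exprMn exprn_gt0.
have w2 : 0 < w%:R ^+ 2 :> R by rewrite exprn_gt0.
have [a1|a1] := leP alpha 1.
  exists 1, w; split.
  - by apply/adm => /=; clear -w0; lia.
  - by rewrite nuE !absz_nat eqz_nat eqn0Ngt w0 /= !muln0 mul0n !addn0 mul1n.
  - by rewrite /energy -!pmulrn; lra.
  - by rewrite /energy -!pmulrn; nra.
exists w, 1; split.
- by apply/adm; case: ifP.
- by rewrite nuE !absz_nat eqz_nat eqn0Ngt w0 /= !muln0 mul0n !addn0 muln1.
- by rewrite /energy -!pmulrn; lra.
- by rewrite /energy -!pmulrn; nra.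
Qed.

(** The upper bound of [klein_even_count] is nearly attained, by [(2 * w, 0)]
    or by [(0, 2 * w - 1)] according to whether [alpha <= 1]. *)
Lemma klein_last_witness w : prime w -> exists m n,
  [/\ admissible M m n, nu m n = (2 * w)%N,
      energy alpha m n <= (D%:R * w%:R) ^+ 2 &
      (2 * Num.max alpha 1 * w%:R - alpha) ^+ 2 <= energy alpha m n].
Proof.
move=> pw; have al0 := alpha_gt0; have w0 := prime_gt0 pw.
have D3 := alphaD.
have w1 : 1 <= w%:R :> R by rewrite ler1n.
have aw : 0 < alpha * w%:R by rewrite mulr_gt0// ltr0n.
have Dw : 2 * w%:R <= D%:R * w%:R :> R by rewrite ler_wpM2r//; lra.
have Daw : 2 * (alpha * w%:R) <= D%:R * w%:R :> R.
  by rewrite mulrA ler_wpM2r//; lra.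
have aaw : alpha <= alpha * w%:R by rewrite ler_peMr// ltW.
have [a1|a1] := leP alpha 1.
  have E : energy alpha (2 * w)%N 0 = (2 * w%:R) ^+ 2.
    by rewrite /energy mulr0z expr0n mulr0 addr0 -pmulrn natrM.
  exists (2 * w)%N, 0; rewrite E; split.
  - by apply/adm; rewrite absz_nat mul2n odd_double.
  - by rewrite nuE absz0 absz_nat !muln0 eqz_nat eqn0Ngt muln_gt0 w0 /= muln1.
  - by apply: sqr_mono; lra.
  - by apply: sqr_mono; lra.
have E : energy alpha 0 (2 * w - 1)%N = (alpha * (2 * w%:R - 1)) ^+ 2.
  rewrite /energy mulr0z expr0n add0r -pmulrn natrB ?natrM ?exprMn//.
  by clear -w0; lia.
exists 0, (2 * w - 1)%N; rewrite E; split.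
- by apply/adm.
- by rewrite nuE absz0 absz_nat !mul0n addn0 muln0 add0n mul1n; clear -w0; lia.
- by apply: sqr_mono; lra.
- by apply: sqr_mono; lra.
Qed.

Lemma klein_count_first_bounds w : prime w -> (4 * D ^ 2 * B < w)%N ->
  `|(klein_count_first S w)%:R - Num.min alpha 1 / (2 * alpha) * w%:R|
    <= 2 + 1 / alpha.
Proof.
move=> pw wB; have al0 := alpha_gt0; have D3 := alphaD.
have w1 : 1 <= w%:R :> R by rewrite ler1n prime_gt0.
have [m [n [amn nw e0 ew]]] := klein_first_witness pw.
have even := klein_even_count pw.
have mn1 : Num.min alpha 1 <= 1 by rewrite ge_min lexx orbT.
have mna : Num.min alpha 1 <= alpha by rewrite ge_min lexx.
have mn0 : 0 < Num.min alpha 1 by rewrite lt_min alpha_gt0 ltr01.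
move: (Num.min alpha 1) ew mn1 mna mn0 even => mn ew mn1 mna mn0 even.
have mnw : 0 < mn * w%:R by rewrite mulr_gt0//; lra.
set t := mn / (2 * alpha) * w%:R.
have tE : 2 * (alpha * t) = mn * w%:R by rewrite /t; field; lra.
have t0 : 0 < t by rewrite /t mulr_gt0 ?divr_gt0 ?mulr_gt0//; lra.
set s := 1 / alpha; have sE : alpha * s = 1 by rewrite /s; field; lra.
have s0 : 0 < s by rewrite /s divr_gt0.
have lower : t - 1 <= (klein_count_first S w)%:R.
  apply: count_below_ge => [i iw it|]; last first.
    suff : t <= w%:R by lra.
    by rewrite /t ler_piMl// ler_pdivrMr; lra.
  case/(precedesE data) =>
    m1 [n1 [m2 [n2 [[a1 a2] /esym/(even _ _ a1)[e1 _]]]]].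
  move=> /esym/(klein_odd_count a2) -> /andP[_]; apply/negP; rewrite -leNgt.
  apply: le_trans e1; rewrite ler_pXn2r ?nnegrE ?(ltW mnw)//; last first.
    by apply: mulr_ge0; [lra|have := ler0n R i; lra].
  have : alpha * i%:R <= alpha * (t - 1) by rewrite ler_pM2l.
  lra.
have upper : (klein_count_first S w)%:R <= t + s + 1.
  apply: count_below_le => [|i iw]; first by lra.
  apply: contra_notP => /negP; rewrite -ltNge => lti.
  have [ai ei] := klein_odd_admissible i; rewrite -nw -ei.
  apply: (precedesI alpha_gt0 data (A := (D * w)%N) (B := B)) => //.
  - rewrite e0 /= klein_odd_energy; apply: le_lt_trans ew _.
    have : alpha * (t + s) < alpha * i%:R by rewrite ltr_pM2l.
    by move=> h; rewrite ltr_pXn2r ?nnegrE//; lra.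
  - rewrite klein_odd_energy natrM; apply: sqr_mono.
      by apply: mulr_ge0; [lra|have := ler0n R i; lra].
    apply: (@le_trans _ _ (alpha * (2 * w%:R))).
      rewrite ler_pM2l//; have : i%:R + 1 <= w%:R :> R by rewrite natr1 ler_nat.
      by lra.
    by rewrite mulrA ler_wpM2r//; lra.
  - exact: cube_exceeds_box D_pos (inv_bound_gt0 alpha_gt0 alphaB) wB.
by rewrite ler_norml; lra.
Qed.

Lemma klein_count_last_bounds w : prime w -> (4 * D ^ 2 * B < w)%N ->
  `|(klein_count_last S w)%:R - Num.max alpha 1 / alpha * w%:R|
    <= 2 + 1 / alpha.
Proof.
move=> pw wB; have al0 := alpha_gt0.
have w1 : 1 <= w%:R :> R by rewrite ler1n prime_gt0.
have [m [n [amn nw eD ew]]] := klein_last_witness pw.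
have even := klein_even_count pw.
have mx1 : 1 <= Num.max alpha 1 by rewrite le_max lexx orbT.
have mxa : alpha <= Num.max alpha 1 by rewrite le_max lexx.
have mxB : Num.max alpha 1 / alpha <= B%:R.
  rewrite ler_pdivrMr// ge_max; apply/andP; split.
    by rewrite ler_peMl ?ler1n ?(inv_bound_gt0 alpha_gt0 alphaB)// ltW.
  by rewrite -ler_pdivrMr// div1r.
move: (Num.max alpha 1) ew mx1 mxa mxB even => mx ew mx1 mxa mxB even.
have mxw : 0 < mx * w%:R by rewrite mulr_gt0//; lra.
set t := mx / alpha * w%:R.
have tE : alpha * t = mx * w%:R by rewrite /t; field; lra.
have t0 : 0 < t by rewrite /t mulr_gt0 ?divr_gt0 ?mulr_gt0//; lra.
set s := 1 / alpha; have sE : alpha * s = 1 by rewrite /s; field; lra.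
have s0 : 0 < s by rewrite /s divr_gt0.
have lower : t - 2 <= (klein_count_last S w)%:R.
  apply: count_below_ge => [i iw it|]; last first.
    suff : t <= (w ^ 2)%:R by lra.
    rewrite /t expnS expn1 natrM ler_wpM2r// (le_trans mxB)// ler_nat.
    by have := D_pos; clear -wB; case: (D) wB => // D' wB _; nia.
  have [ai ei] := klein_odd_admissible i; rewrite -nw -ei.
  have i0 := ler0n R i.
  have pos : 0 < alpha * (2 * i%:R + 2) by rewrite mulr_gt0//; lra.
  apply: (precedesI alpha_gt0 data (A := (D * w)%N) (B := B)) => //.
  - rewrite klein_odd_energy exprn_gt0//=; apply: lt_le_trans ew.
    have : alpha * i%:R <= alpha * (t - 2) by rewrite ler_pM2l.
    by move=> h; rewrite ltr_pXn2r ?nnegrE//; lra.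
  - by rewrite natrM.
  - exact: cube_exceeds_box D_pos (inv_bound_gt0 alpha_gt0 alphaB) wB.
have upper : (klein_count_last S w)%:R <= t + s + 1.
  apply: count_below_le => [|i iw]; first by lra.
  case/(precedesE data) => m1 [n1 [m2 [n2 [[a1 a2] +
    /esym/(even _ _ a2)[_ e2]]]]].
  move=> /esym/(klein_odd_count a1) -> /andP[_ /lt_le_trans/(_ e2)].
  have i0 := ler0n R i.
  have pos : 0 < alpha * (2 * i%:R + 2) by rewrite mulr_gt0//; lra.
  rewrite ltr_pXn2r ?nnegrE ?(ltW pos)//; last by lra.
  by move=> h; rewrite -(ler_pM2l al0); lra.
by rewrite ler_norml; lra.
Qed.
End KleinMethod.

(** * Programs computing the counts *)

Definition eq_term a b := IsZero (Add (Monus a b) (Monus b a)).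

Definition prime_term (i : nat) : term :=
  Mul (IsZero (Monus (Cst 2) (Var i)))
      (IsZero (Sum (Var i)
                 (Sum (Var i.+1) (eq_term (Mul (Var 0) (Var 1)) (Var i.+2))))).

(** The largest prime below [k + 3], found as the only [p] for which the
    summand does not vanish; the offset makes room for the prime [2]. *)
Definition largest_prime_term : term :=
  Sum (Add (Var 0) (Cst 3))
    (Mul (Mul (Var 0) (prime_term 0))
       (IsZero (Sum (Add (Var 1) (Cst 3))
                  (Mul (prime_term 0)
                     (IsZero (Monus (Add (Var 1) (Cst 1)) (Var 0))))))).

Definition cube_term a := Mul a (Mul a a).

(** The terms [u] and [v] stand below two binders: variable [0] is the earlier
    and variable [1] the later position. *)
Definition precedes_term (K u v : term) : term :=
  Sum K (Sum (Var 0) (Mul (Occurs (Var 0) u) (Occurs (Var 1) v))).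

Definition rectangle_term : term :=
  Sum (Var 0) (IsZero (precedes_term (cube_term (Var 1)) (Var 3) (Var 2))).

Definition torus_term : term :=
  Sum (Var 0) (IsZero (precedes_term (cube_term (Var 1))
    (Add (Mul (Cst 4) (Var 3)) (Cst 2)) (Add (Mul (Cst 4) (Var 2)) (Cst 2)))).

Definition klein_first_term : term :=
  Sum (Var 0) (IsZero (precedes_term (cube_term (Var 1))
    (Mul (Cst 2) (Var 3)) (Add (Mul (Cst 2) (Var 2)) (Cst 3)))).

Definition klein_last_term : term :=
  Sum (Mul (Var 0) (Var 0)) (IsZero (IsZero (precedes_term (cube_term (Var 1))
    (Add (Mul (Cst 2) (Var 2)) (Cst 3)) (Mul (Cst 2) (Var 3))))).

Section Eval.
Variable S : nat -> set nat.

Lemma eval_prime i xs : eval S (prime_term i) xs = prime (nth 0%N xs i).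
Proof.
rewrite [LHS]/= subn_eq0; set p := nth 0%N xs i.
have [p1|p1] /= := ltnP 1 p; last first.
  by rewrite mul0n; case: (p) p1 => [|[]].
rewrite mul1n; congr nat_of_bool.
apply/idP/idP.
  rewrite sum_nat_eq0 => /forallP H; apply/primeP; split => // d dp.
  have d0 : (0 < d)%N by apply: dvdn_gt0 dp; apply: ltnW.
  have := divnK dp; set e := (p %/ d)%N => eE.
  have [->|d1] := eqVneq d 1%N; first by [].
  have [e1|e1] := eqVneq e 1%N; first by rewrite -eE e1 mul1n eqxx orbT.
  have e0 : (0 < e)%N by case: (e) eE => //; rewrite mul0n => e0;
    rewrite -e0 in p1.
  have dlt : (d < p)%N by rewrite -eE ltn_Pmull// ltn_neqAle eq_sym e1.
  have elt : (e < p)%N by rewrite -eE ltn_Pmulr// ltn_neqAle eq_sym d1.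
  have := H (Ordinal dlt); rewrite sum_nat_eq0 => /forallP/(_ (Ordinal elt)).
  by rewrite /= -/p eE subnn.
move=> pp; rewrite sum_nat_eq0; apply/forallP => -[a ap].
rewrite sum_nat_eq0; apply/forallP => -[b bp] /=.
rewrite eqb0 addn_eq0 !subn_eq0 -eqn_leq; apply/eqP => /(prime_factors pp).
by move: ap bp; rewrite -/p => ap bp [[_ ab]|[ab _]]; rewrite ab ltnn in ap bp.
Qed.

Definition largest_prime k := eval S largest_prime_term [:: k].

Lemma largest_primeP k : prime (largest_prime k) /\
  forall q, prime q -> (q < k + 3)%N -> (q <= largest_prime k)%N.
Proof.
have ex : exists p, prime p && (p < k + 3)%N by exists 2%N; rewrite addn3.
have ub p : prime p && (p < k + 3)%N -> (p <= k + 3)%N.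
  by case/andP => _ /ltnW.
case: (ex_maxnP ex ub) => p /andP[pp pk] pmax.
suff -> : largest_prime k = p.
  by split => // q qp qk; apply: pmax; rewrite qp.
rewrite /largest_prime /largest_prime_term.
have -> : eval S (Sum (Add (Var 0) (Cst 3)) (Mul (Mul (Var 0) (prime_term 0))
  (IsZero (Sum (Add (Var 1) (Cst 3)) (Mul (prime_term 0)
     (IsZero (Monus (Add (Var 1) (Cst 1)) (Var 0)))))))) [:: k] =
  (\sum_(i < k + 3) i * prime i *
    (\sum_(j < k + 3) prime j * (i + 1 - j == 0) == 0))%N.
  apply: eq_bigr => i _.
  rewrite -[X in (_ = i * X * _)%N](eval_prime 0 [:: nat_of_ord i; k]).
  congr (_ * (_ == 0)%N)%N; apply: eq_bigr => j _.
  by rewrite -[X in (_ = X * _)%N](eval_prime 0 [:: nat_of_ord j;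
    nat_of_ord i; k]).
rewrite (bigD1 (Ordinal pk))//= pp muln1 [X in (X == 0)%N]big1; last first.
  move=> [j jk] _ /=; case pj: (prime j) => //=; rewrite mul1n.
  by apply/eqP; rewrite eqb0 subn_eq0 -ltnNge addn1 ltnS; apply: pmax;
    rewrite pj.
rewrite muln1 big1 ?addn0//.
move=> [i ik] /eqP ip; case pri: (prime i); last by rewrite muln0.
rewrite sum_nat_eq0; case: forallP => [H|_]; last by rewrite muln0.
have := H (Ordinal pk); rewrite /= pp mul1n eqb0 subn_eq0 addn1 -leqNgt => ip'.
exfalso; apply: ip; apply: val_inj => /=; apply/eqP; rewrite eqn_leq ip' andbT.
by apply: pmax; rewrite pri.
Qed.

Lemma eval_precedes K u v xs k U V :
  eval S K xs = k ->
  (forall i j, eval S u [:: i, j & xs] = U) ->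
  (forall i j, eval S v [:: i, j & xs] = V) ->
  eval S (IsZero (precedes_term K u v)) xs = ~~ `[< precedes S k U V >].
Proof.
move=> kE uE vE.
rewrite -[LHS]/(nat_of_bool (eval S (precedes_term K u v) xs == 0%N)).
have -> : eval S (precedes_term K u v) xs =
    (\sum_(j < k) \sum_(i < j) `[< S i U >] * `[< S j V >])%N.
  rewrite -kE; apply: eq_bigr => j _; apply: eq_bigr => i _.
  by rewrite -(uE i j) -(vE i j).
congr nat_of_bool; rewrite sum_nat_eq0; apply/idP/idP.
  move=> /forallP H; apply/negP => /asboolP[i [j [ij jk Si Sj]]].
  have := H (Ordinal jk); rewrite sum_nat_eq0 => /forallP/(_ (Ordinal ij)) /=.
  by rewrite !asboolT.
move=> nP; apply/forallP => -[j jk]; rewrite sum_nat_eq0;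
  apply/forallP => -[i ij].
case: asboolP => //= Si; case: asboolP => //= Sj.
by case/negP: nP; apply/asboolP; exists i, j.
Qed.

Lemma eval_cube i xs : eval S (cube_term (Var i)) xs = (nth 0%N xs i ^ 3)%N.
Proof. by rewrite /= !expnS expn0 muln1. Qed.

Lemma eval_sum a b xs : eval S (Sum a b) xs =
  (\sum_(i < eval S a xs) eval S b (nat_of_ord i :: xs))%N.
Proof. by []. Qed.

Lemma eval_is_zero a xs :
  eval S (IsZero a) xs = (eval S a xs == 0%N).
Proof. by []. Qed.

Lemma eval_rectangle p : eval S rectangle_term [:: p] = rectangle_count S p.
Proof.
rewrite eval_sum; apply: eq_bigr => i _; rewrite asbool_neg.
exact: (eval_precedes (U := p) (V := i) (eval_cube _ _)).
Qed.

Lemma eval_torus p : eval S torus_term [:: p] = torus_count S p.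
Proof.
rewrite eval_sum; apply: eq_bigr => i _; rewrite asbool_neg.
by apply: (eval_precedes (U := 4 * p + 2) (V := 4 * i +
  2) (eval_cube _ _)) => j k.
Qed.

Lemma eval_klein_first p : eval S klein_first_term [:: p] =
  klein_count_first S p.
Proof.
rewrite eval_sum; apply: eq_bigr => i _; rewrite asbool_neg.
by apply: (eval_precedes (U := 2 * p) (V := 2 * i + 3) (eval_cube _ _)) => j k.
Qed.

Lemma eval_klein_last p : eval S klein_last_term [:: p] = klein_count_last S p.
Proof.
rewrite /klein_count_last -mulnn.
rewrite eval_sum; apply: eq_bigr => i _.
rewrite eval_is_zero.
by rewrite (eval_precedes (U := 2 * i + 3) (V :=
  2 * p) (eval_cube _ _))// eqb0 negbK.
Qed.

End Eval.

(** * Reconstruction of the parameter *)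

(** The approximants depend on the nodal sequence alone; so the same programs
    serve for all parameters, and equal sequences have equal limits. *)
Lemma reconstructible_by (R : realType) (D : set R) (M : R -> surface R)
    (stage num den : term) :
  (forall S k, 0 < eval S den [:: eval S stage [:: k]])%N ->
  (forall alpha, D alpha -> let S := nodal_sequence (M alpha) in
    ((eval S num [:: eval S stage [:: k]])%:R /
     (eval S den [:: eval S stage [:: k]])%:R : R) @[k --> \oo] --> alpha) ->
  reconstructible D M /\
  forall alpha alpha', D alpha -> D alpha' ->
    nodal_sequence (M alpha) = nodal_sequence (M alpha') -> alpha = alpha'.
Proof.
move=> den0 lim; split.
  have run1 S e k : run S (Comp (compile 1 e) [:: compile 1 stage]) [:: k]
      (eval S e [:: eval S stage [:: k]]).
    exact: run_comp1 (run_compile S stage [:: k]) (run_compile S e [:: _]).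
  exists (Comp (compile 1 num) [:: compile 1 stage]),
    (Comp (compile 1 den) [:: compile 1 stage]) => alpha Da.
  set S := nodal_sequence (M alpha).
  exists (fun k => eval S num [:: eval S stage [:: k]]),
    (fun k => eval S den [:: eval S stage [:: k]]); split => //.
  exact: lim.
move=> alpha alpha' Da Da' SE; have := lim _ Da'; rewrite -SE.
by apply: cvg_unique => //; exact: lim.
Qed.

Lemma largest_prime_cvg S : largest_prime S k @[k --> \oo] --> \oo.
Proof.
apply/cvgnyPge => N; have [q Nq pq] := prime_above N; near=> k.
have [_ /(_ q pq)] := largest_primeP S k.
have qk : (q < k + 3)%N by apply: ltn_addr; near: k; exact: nbhs_infty_gt.
by move=> /(_ qk); apply: leq_trans; exact: ltnW.
Unshelve. all: by end_near. Qed.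

Lemma large_prime (S : nat -> set nat) (P : nat -> Prop) N :
  (forall p, prime p -> (N < p)%N -> P p) ->
  \forall k \near \oo, P (largest_prime S k).
Proof.
move=> HP; near=> k; apply: HP; first by have [] := largest_primeP S k.
near: k; have /cvgnyPgt := @largest_prime_cvg S; exact.
Unshelve. all: by end_near. Qed.

Lemma inv_bound (R : realType) (alpha : R) : 0 < alpha ->
  alpha^-1 <= (Num.bound alpha^-1)%:R.
Proof. by move=> a0; apply/ltW/archi_boundP; rewrite invr_ge0 ltW. Qed.

Lemma rectangle_reconstruction (R : realType) (M : R -> surface R) (c : R)
    (nu : int -> int -> nat) :
  (forall m n, nu m n = `|m| * `|n|)%N ->
  (forall alpha, 0 < alpha -> has_nodal_data (M alpha) alpha c nu) ->
  (forall alpha m n, admissible (M alpha) m n <-> 1 <= m /\ 1 <= n) ->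
  reconstructible [set alpha : R | 0 < alpha <= 1] M /\
  forall alpha alpha' : R, 0 < alpha <= 1 -> 0 < alpha' <= 1 ->
    nodal_sequence (M alpha) = nodal_sequence (M alpha') -> alpha = alpha'.
Proof.
move=> nuE data adm.
apply: (@reconstructible_by _ _ _ largest_prime_term rectangle_term (Var 0)).
  by move=> S k; have [/prime_gt0] := largest_primeP S k.
move=> alpha /andP[a0 a1] S; have aB := inv_bound a0.
under eq_fun do rewrite eval_rectangle.
apply: (ratio_cvg (w := largest_prime S) (C := 2) (@largest_prime_cvg S)).
apply: (@large_prime S (fun p =>
  `|(rectangle_count S p)%:R - alpha * p%:R| <= 2) _).
move=> p; exact: (rectangle_count_bounds a0 (data _ a0) aB a1 (adm alpha) nuE).
Qed.

Lemma torus_reconstruction (R : realType) (M : R -> surface R) (c : R)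
    (nu : int -> int -> nat) :
  (forall m n, nu m n = (2 * `|m| + (m == 0)) * (2 * `|n| + (n == 0)))%N ->
  (forall alpha, 0 < alpha -> has_nodal_data (M alpha) alpha c nu) ->
  (forall alpha m n, admissible (M alpha) m n) ->
  reconstructible [set alpha : R | 0 < alpha <= 1] M /\
  forall alpha alpha' : R, 0 < alpha <= 1 -> 0 < alpha' <= 1 ->
    nodal_sequence (M alpha) = nodal_sequence (M alpha') -> alpha = alpha'.
Proof.
move=> nuE data adm.
apply: (@reconstructible_by _ _ _ (Add (Var 0) (Cst 1)) torus_term (Var 0)).
  by move=> S k; rewrite /= addn1.
move=> alpha /andP[a0 a1] S; have aB := inv_bound a0.
under eq_fun do rewrite eval_torus.
apply: (ratio_cvg (w := fun k => (k + 1)%N) (C := 1)).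
  by apply/cvgnyPge => N; near=> k; rewrite addn1 ltnW// ltnS; near: k;
    exact: nbhs_infty_ge.
near=> k; apply: (torus_count_bounds a0 (data _ a0) aB a1 (adm alpha) nuE).
by rewrite /= addn1 ltnS; near: k; exact: nbhs_infty_ge.
Unshelve. all: by end_near. Qed.

(** The two measurements [fst] and [lst] have the limits
    [min alpha 1 / (2 * alpha)] and [max alpha 1 / alpha], with product
    [1 / (2 * alpha)].  Adding [1] to the denominator [2 * n1 * n2] of the
    approximant keeps it positive and changes nothing in the limit. *)
Lemma klein_reconstruction (R : realType) (M : R -> surface R) (c : R)
    (nu : int -> int -> nat) :
  (forall m n, nu m n =
    (2 * (`|m| * `|n|) + (m == 0) * (`|n| + 1) + `|m| * (n == 0))%N) ->
  (forall alpha, 0 < alpha -> has_nodal_data (M alpha) alpha c nu) ->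
  (forall alpha m n, admissible (M alpha) m n <->
                     if odd `|m|%N then n <> 0 else 0 <= n) ->
  reconstructible [set alpha : R | 0 < alpha] M /\
  forall alpha alpha' : R, 0 < alpha -> 0 < alpha' ->
    nodal_sequence (M alpha) = nodal_sequence (M alpha') -> alpha = alpha'.
Proof.
move=> nuE data adm.
apply: (@reconstructible_by _ _ _ largest_prime_term (Mul (Var 0) (Var 0))
   (Add (Mul (Cst 2) (Mul klein_first_term klein_last_term)) (Cst 1))).
  by move=> S k; rewrite [eval _ _ _]addn1.
move=> alpha a0 S; have aB := inv_bound a0.
set D := Num.bound (3 * (alpha + 1)).
have aD : 3 * (alpha + 1) <= D%:R.
  by apply/ltW/archi_boundP; rewrite mulr_ge0// addr_ge0// ltW.
pose w := largest_prime S.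
pose fst k : R := (klein_count_first S (w k))%:R / (w k)%:R.
pose lst k : R := (klein_count_last S (w k))%:R / (w k)%:R.
have winf : w k @[k --> \oo] --> \oo := @largest_prime_cvg S.
have cfst : fst k @[k --> \oo] --> Num.min alpha 1 / (2 * alpha).
  apply: (ratio_cvg (C := 2 + 1 / alpha) winf).
  apply: (@large_prime S (fun p =>
    `|(klein_count_first S p)%:R - _ * p%:R| <= _) _).
  move=> p; exact: (klein_count_first_bounds a0 (data _ a0) (adm alpha) nuE
    aB aD).
have clst : lst k @[k --> \oo] --> Num.max alpha 1 / alpha.
  apply: (ratio_cvg (C := 2 + 1 / alpha) winf).
  apply: (@large_prime S (fun p => `|(klein_count_last S p)%:R - _ * p%:R| <=
    _) _).
  move=> p; exact: (klein_count_last_bounds a0 (data _ a0) (adm alpha) nuE aB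
    aD).
have cinv : (1%:R / (w k)%:R : R) @[k --> \oo] --> (0 : R).
  apply: (ratio_cvg (C := 1) winf); near=> k.
  by rewrite mul0r subr0 normr1.
have w0 k : (w k)%:R != 0 :> R.
  by rewrite pnatr_eq0 -lt0n; have [/prime_gt0] := largest_primeP S k.
have -> : (fun k => (eval S (Mul (Var 0) (Var 0)) [:: w k])%:R /
    (eval S (Add (Mul (Cst 2) (Mul klein_first_term klein_last_term)) (Cst 1))
      [:: w k])%:R) =
    (fun k => (2 * (fst k * lst k) +
      (1 / (w k)%:R) * (1 / (w k)%:R))^-1) :> (nat -> R).
  apply/funext => k.
  have -> : eval S (Add (Mul (Cst 2) (Mul klein_first_term klein_last_term))
    (Cst 1))
      [:: w k] = (2 * (klein_count_first S (w k) * klein_count_last S (w k))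
        + 1)%N.
    by rewrite -eval_klein_first -eval_klein_last.
  rewrite [eval _ _ _]/= /fst /lst natrD !natrM.
  have := w0 k; move: ((w k)%:R : R) => W W0.
  have den0 : 2 * ((klein_count_first S (w k))%:R * (klein_count_last S (w
    k))%:R) + 1 != 0 :> R.
    by rewrite -!natrM natr1 pnatr_eq0.
  by field; rewrite W0 den0.
have -> : alpha = (2 * (Num.min alpha 1 / (2 * alpha) * (Num.max alpha 1 /
  alpha))
    + 0 * 0)^-1.
  have mm : Num.min alpha 1 * Num.max alpha 1 = alpha.
    by case: leP => _; rewrite ?mulr1 ?mul1r.
  by rewrite mulr0 addr0 mulf_div mm; field; exact: lt0r_neq0.
apply: cvgV; last first.
  apply: cvgD; last exact: cvgM.
  by apply: cvgMr; apply: cvgM.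
by rewrite mulr0 addr0 !mulf_neq0 ?invr_neq0 ?mulf_neq0 ?lt0r_neq0// ?lt_min
  ?lt_max ?a0 ?ltr01.
Unshelve. all: by end_near. Qed.

(** * Nodal domains as fibres of a label *)

Lemma connected_star (T : topologicalType) (A : set T) (c : T) :
  (forall x, A x -> exists C, [/\ connected C, C `<=` A, C x & C c]) ->
  connected A.
Proof.
move=> star; have [C CP] : {C : T -> set T & forall x, A x ->
    [/\ connected (C x), C x `<=` A, C x x & C x c]}.
  apply: (@choice _ _ (fun x C => A x ->
    [/\ connected C, C `<=` A, C x & C c])).
  by move=> x; have [/star[C]|nA] := pselect (A x); [exists C|exists set0].
have -> : A = \bigcup_(x in A) C x.
  apply/seteqP; split => [x Ax|y [x Ax]]; first by exists x => //;
    case: (CP x Ax).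
  by have [_ + _ _] := CP x Ax; apply.
apply: bigcup_connected; last by move=> x /CP[].
by exists c => x /CP[].
Qed.

(** A connected subset of [U] that meets a fibre stays in it, since the fibre
    and the union of the others are both open. *)
Lemma component_label (T : topologicalType) (L : Type) (U : set T) (l : T ->
  L) :
  (forall t, open (U `&` l @^-1` [set t])) ->
  (forall t, connected (U `&` l @^-1` [set t])) ->
  forall x, U x -> connected_component U x = U `&` l @^-1` [set l x].
Proof.
move=> lopen lconn x Ux; apply/seteqP; split; last first.
  by apply: connected_component_max; [split|apply: subIsetl|apply: lconn].
set C := connected_component U x.
have CU : C `<=` U := @connected_component_sub _ _ _.
suff <- : C `&` (U `&` l @^-1` [set l x]) = C by apply: subIsetr.
apply: (@component_connected _ U x).
- by exists x; split; [apply: connected_component_refl|split].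
- by exists (U `&` l @^-1` [set l x]).
exists (~` \bigcup_(t in [set t | t <> l x]) (U `&` l @^-1` [set t])).
  by apply: open_closedC; apply: bigcup_open => t _; apply: lopen.
apply/seteqP; split => y [Cy].
  by move=> [Uy /= lyx]; split => // -[t /= tx [_ lyt]]; apply: tx;
    rewrite -lyt.
move=> nb; split => //; split; first exact: CU.
by apply: contrapT => /= lyx; apply: nb; exists (l y) => //; split => //;
  apply: CU.
Qed.

(** Labels are pairs because the cells of a grid are indexed by pairs. *)
Lemma nodal_count_label (R : realType) (M : surface R) (f : space M -> R)
    (l : space M -> nat * nat) (a b v : nat) :
  let U := off_nodal_set f in
  (forall t, open (U `&` l @^-1` [set t])) ->
  (forall t, connected (U `&` l @^-1` [set t])) ->
  l @` U = `I_a `*` `I_b ->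
  nodal_count f v <-> v = (a * b)%N.
Proof.
move=> U lopen lconn lU.
have domE : nodal_domains f =
    (fun t => U `&` l @^-1` [set t]) @` (`I_a `*` `I_b).
  rewrite -lU image_comp; apply: eq_imagel => x Ux.
  exact: component_label.
have card : (nodal_domains f #= `I_(a * b))%card.
  rewrite domE; apply: (card_eq_trans (B := `I_a `*` `I_b)).
    apply: inj_card_eq => s t; rewrite !inE -lU => -[x Ux <-] _ E.
    have : (U `&` l @^-1` [set l x]) x by [].
    by rewrite E => -[].
  pose g (t : nat * nat) := (t.1 * b + t.2)%N.
  have <- : g @` (`I_a `*` `I_b) = `I_(a * b).
    apply/seteqP; split => [_ [[i j] [/= ia jb] <-]|k /= kab].
      by rewrite /g /=; nia.
    have b0 : (0 < b)%N by case: (b) kab => //; rewrite muln0.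
    exists (k %/ b, k %% b)%N; last by rewrite /g -divn_eq.
    by split; rewrite /= ?ltn_divLR// ltn_mod.
  rewrite card_eq_sym; apply: inj_card_eq => -[i j] [i' j'].
  rewrite !inE => -[/= _ jb] [/= _ j'b]; rewrite /g /= => E.
  have b0 : (0 < b)%N by apply: leq_ltn_trans jb.
  have := congr1 (modn^~ b) E; rewrite !modnMDl !modn_small// => jj.
  by move: E; rewrite jj => /addIn/eqP; rewrite eqn_pmul2r// => /eqP ->.
split=> [cv|->//]; apply/eqP; rewrite eqn_leq -!card_le_II.
have := card_eq_trans (card_esym cv) card.
by rewrite card_eq_le.
Qed.

(** * Grids in the plane *)

Section Line.
Variable R : realType.
Implicit Types (A s x t : R) (i : int).

Definition between i t : Prop := i%:~R < t < i%:~R + 1.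

Definition off_grid t : Prop := between (Num.floor t) t.

Lemma between_floor i t : between i t -> Num.floor t = i.
Proof. by move=> /andP[it ti]; apply: floor_def; rewrite intrD ltW. Qed.

Lemma between_off_grid i t : between i t -> off_grid t.
Proof. by move=> it; rewrite /off_grid (between_floor it). Qed.

Lemma off_gridE t : off_grid t <-> (Num.floor t)%:~R != t.
Proof.
rewrite /off_grid /between lt_neqAle floor_le andbT.
have := floorD1_gt t; rewrite intrD => ->; rewrite andbT.
by [].
Qed.

Lemma floorDz t i : off_grid t -> Num.floor (t + i%:~R) = Num.floor t + i.
Proof.
move=> /andP[h1 h2]; apply: between_floor.
by rewrite /between intrD; lra.
Qed.

(** Off the integers, a reflection maps the open interval starting at
    [floor t] to the one ending at [i - floor t]. *)
Lemma floor_reflect t i : off_grid t ->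
  Num.floor (i%:~R - t) = i - 1 - Num.floor t.
Proof.
move=> /andP[h1 h2]; apply: between_floor.
by rewrite /between !intrD !mulrNz; lra.
Qed.

Lemma sincosD_int (x : R) (k : int) :
  sin (x + pi * k%:~R) = (-1) ^+ odd `|k|%N * sin x /\
  cos (x + pi * k%:~R) = (-1) ^+ odd `|k|%N * cos x.
Proof.
have nat_case (y : R) n : sin (y + pi * n%:R) = (-1) ^+ odd n * sin y /\
    cos (y + pi * n%:R) = (-1) ^+ odd n * cos y.
  elim: n => [|n [ihs ihc]]; first by rewrite mulr0 addr0 !mul1r.
  rewrite -natr1 mulrDr mulr1 addrA sinDpi cosDpi ihs ihc /= signrN.
  by rewrite !mulNr.
case: k => n; first by rewrite -pmulrn; exact: nat_case.
have [hs hc] := nat_case (x + pi * (Negz n)%:~R) n.+1.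
have e : x + pi * (Negz n)%:~R + pi * n.+1%:R = x by rewrite NegzE mulrNz; ring.
rewrite e in hs hc.
by split; [rewrite [in RHS]hs|rewrite [in RHS]hc]; rewrite signrMK.
Qed.

Lemma sin_add_int t i :
  sin (pi * t) != 0 :> R -> sin (pi * (t + i%:~R)) != 0 :> R.
Proof.
have [e _] := sincosD_int (pi * t) i.
by rewrite mulrDr e mulf_eq0 signr_eq0.
Qed.

Lemma sin_pi_neq0 t : sin (pi * t) != 0 :> R <-> off_grid t.
Proof.
have tE : t = (t - (Num.floor t)%:~R) + (Num.floor t)%:~R by rewrite subrK.
split=> [|/andP[h1 h2]]; last first.
  rewrite tE; apply: sin_add_int; apply: lt0r_neq0; apply: sin_gt0_pi.
  apply/andP; split; first by rewrite mulr_gt0 ?pi_gt0// subr_gt0.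
  by rewrite gtr_pMr ?pi_gt0//; lra.
move=> s0; apply/off_gridE/eqP => tf.
have := sin_add_int (- Num.floor t) s0.
by rewrite mulrNz tf subrr mulr0 sin0 eqxx.
Qed.

Lemma cos_pi_neq0 t : cos (pi * t) != 0 :> R <-> off_grid (t + 2^-1).
Proof. by rewrite -sin_pi_neq0 mulrDr sinDpihalf. Qed.

End Line.

Section Cells.
Variable R : realType.
Variables A1 s1 A2 s2 : R.
Implicit Types (i j : int) (p : R * R).

Definition cell i j : set (R * R) :=
  [set p | between i (A1 * p.1 + s1) /\ between j (A2 * p.2 + s2)].

Lemma cell_open i j : open (cell i j).
Proof.
have aff (A s : R) k (pr : R * R -> R) : continuous pr ->
    open [set p | between k (A * pr p + s)].
  move=> cpr.
  have -> : [set p | between k (A * pr p + s)] =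
      (fun p => A * pr p + s) @^-1` `]k%:~R, k%:~R + 1[%classic.
    by apply/seteqP; split => p; rewrite /= in_itv.
  apply: open_comp; last exact: interval_open.
  move=> p _; apply: cvgD; last exact: cvg_cst.
  by apply: cvgMr; exact: cpr.
have -> : cell i j = [set p | between i (A1 * p.1 + s1)] `&`
    [set p | between j (A2 * p.2 + s2)] by [].
apply: openI; apply: aff => p; [exact: cvg_fst|exact: cvg_snd].
Qed.

(** A cell is convex, hence a union of segments issuing from one of its
    points. *)
Lemma cell_connected i j : connected (cell i j).
Proof.
have [[c cc]|/set0P/negP/negPn/eqP ->] := pselect (cell i j !=set0);
  last exact: connected0.
apply: (@connected_star _ _ c) => p cp.
pose g (t : R) := (c.1 + t * (p.1 - c.1), c.2 + t * (p.2 - c.2)).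
exists (g @` `[0, 1]%classic); split.
- apply: connected_continuous_connected; first exact: segment_connected.
  apply: continuous_subspaceT => t.
  apply: (@cvg_pair _ _ _ _ (nbhs _) (nbhs _)).
    by apply: cvgD; [exact: cvg_cst|apply: cvgMl; exact: cvg_id].
  by apply: cvgD; [exact: cvg_cst|apply: cvgMl; exact: cvg_id].
- move=> _ [t /= t01 <-]; move: cc cp t01; rewrite /cell /between /= in_itv /=.
  case: c p {g} => [c1 c2] [p1 p2] /= [/andP[a1 a2] /andP[a3 a4]].
  move=> [/andP[b1 b2] /andP[b3 b4]] /andP[t0 t1].
  have h (A s u v : R) : A * (u + t * (v - u)) + s =
      (1 - t) * (A * u + s) + t * (A * v + s) by ring.
  rewrite !h.
  have conv (x y lo hi : R) : lo < x -> x < hi -> lo < y -> y < hi ->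
      lo < (1 - t) * x + t * y < hi.
    have pos a b : 0 < a -> 0 < b -> 0 < (1 - t) * a + t * b.
      move=> a0 b0; have [->|t_neq0] := eqVneq t 0; first by lra.
      have tb : 0 < t * b by rewrite mulr_gt0// lt_neqAle eq_sym t_neq0.
      by have := @mulr_ge0 _ (1 - t) a; lra.
    move=> lx xh ly yh; have := pos (x - lo) (y - lo);
      have := pos (hi - x) (hi - y).
    by rewrite !subr_gt0 => /(_ xh yh) h1 /(_ lx ly) h2; apply/andP; split; lra.
  by split; apply: conv.
- exists 1; first by rewrite /= in_itv /= ler01 lexx.
  by rewrite /g !mul1r [c.1 + _]addrC [c.2 + _]addrC !subrK; case: (p).
- exists 0; first by rewrite /= in_itv /= ler01 lexx.
  by rewrite /g !mul0r !addr0; case: (c).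
Qed.

End Cells.
(** * Grids in a quotient of the plane *)

Local Open Scope quotient_scope.

Section Quotient.
Variables (R : realType) (g1 g2 : R * R -> R * R).
Local Notation proj := (plane_proj g1 g2).
Local Notation orb := (same_orbit g1 g2).
Local Notation Q := (quotient_topology {eq_quot same_orbit_equiv g1 g2}).

Lemma plane_proj_eq p q : orb p q -> proj p = proj q.
Proof. by move=> pq; apply/eqmodP. Qed.

Lemma plane_proj_repr (x : plane_quotient g1 g2) : proj (repr (x : Q)) = x.
Proof. exact: reprK. Qed.

Lemma same_orbit_repr p : orb (repr (proj p : Q)) p.
Proof. by apply/eqmodP; rewrite reprK. Qed.

Lemma plane_proj_continuous : continuous (proj : R * R -> plane_quotient g1 g2).
Proof. exact: (@pi_continuous _ {eq_quot same_orbit_equiv g1 g2}). Qed.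

Lemma same_orbit_ind (P : R * R -> R * R -> Prop) :
  (forall p, P p p) -> (forall p q, P p q -> P q p) ->
  (forall p q r, P p q -> P q r -> P p r) ->
  (forall p, P p (g1 p)) -> (forall p, P p (g2 p)) ->
  forall p q, orb p q -> P p q.
Proof.
move=> Pr Ps Pt P1 P2 p q /asboolP;
  elim=> {p q} [p q [->|->] //|//|p q _|p q r _ pq _].
  exact: Ps.
exact: Pt pq.
Qed.

Variable phi : R * R -> R.
Hypothesis phi1 : forall p, phi (g1 p) = phi p.
Hypothesis phi2 : forall p, phi (g2 p) = phi p.

Lemma descendE p : descend phi (proj p) = phi p.
Proof.
apply: (same_orbit_ind (P := fun p q => phi p =
  phi q)) (same_orbit_repr p) => //.
by move=> ? ? ? -> ->.
Qed.

Section Labels.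
Variables (A1 s1 A2 s2 : R) (lab : int -> int -> nat * nat) (a b : nat).
Variable base : nat * nat -> R * R.

Let ix (p : R * R) := Num.floor (A1 * p.1 + s1).
Let iy (p : R * R) := Num.floor (A2 * p.2 + s2).
Let plab p := lab (ix p) (iy p).

Hypothesis phi_neq0 : forall p,
  phi p != 0 <-> off_grid (A1 * p.1 + s1) /\ off_grid (A2 * p.2 + s2).
Hypothesis lab1 : forall p, phi p != 0 -> plab (g1 p) = plab p.
Hypothesis lab2 : forall p, phi p != 0 -> plab (g2 p) = plab p.
(* Cells with the same label become equal in the quotient: each of them
   contains a point in the orbit of a base point that depends on the label
   only. *)
Hypothesis lab_base : forall p, phi p != 0 ->
  exists q, cell A1 s1 A2 s2 (ix p) (iy p) q /\ orb q (base (plab p)).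
Hypothesis lab_bound : forall p, phi p != 0 -> (`I_a `*` `I_b) (plab p).
Hypothesis lab_onto : forall t, (`I_a `*` `I_b) t ->
  exists p, phi p != 0 /\ plab p = t.

Let l (x : plane_quotient g1 g2) := plab (repr (x : Q)).

Let lE p : phi p != 0 -> l (proj p) = plab p.
Proof.
move=> p0; pose P p q := phi p = phi q /\ (phi p != 0 -> plab p = plab q).
have [] : P (repr (proj p : Q)) p; last first.
  by move=> e; apply; rewrite e.
apply: (same_orbit_ind _ _ _ _ _ (same_orbit_repr p)).
- by [].
- by move=> u v [e h]; split=> // u0; rewrite h// e.
- by move=> u v w [e h] [e' h']; split=> [|u0]; [rewrite e|rewrite h// h'// -e].
- by move=> u; split=> [|u0]; [rewrite phi1|rewrite lab1].
- by move=> u; split=> [|u0]; [rewrite phi2|rewrite lab2].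
Qed.

Let fiberE t : [set p | phi p != 0 /\ plab p = t] =
  \bigcup_(ij in [set ij : int * int | lab ij.1 ij.2 = t])
     cell A1 s1 A2 s2 ij.1 ij.2.
Proof.
apply/seteqP; split => [p [/phi_neq0[p1 p2] pt]|p [[i j] /= ijt [c1 c2]]].
  by exists (ix p, iy p).
split; last by rewrite /plab /ix /iy (between_floor c1) (between_floor c2).
by apply/phi_neq0; split;
  [exact: between_off_grid c1|exact: between_off_grid c2].
Qed.

(** In the quotient, a fibre of the label is open because its preimage is a
    union of cells, and connected because the images of these cells all
    contain the image of the base point. *)
Lemma nodal_count_grid adm psi v :
  nodal_count (M := quotient_surface g1 g2 adm psi) (descend phi) v <->
  v = (a * b)%N.
Proof.
have fiber (x : plane_quotient g1 g2) t :
    (off_nodal_set (M := quotient_surface g1 g2 adm psi) (descend phi)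
       `&` l @^-1` [set t]) x <->
    phi (repr (x : Q)) != 0 /\ plab (repr (x : Q)) = t.
  by split => [[[_ x0] xt]|[x0 xt]].
have fiberp p t :
    (off_nodal_set (M := quotient_surface g1 g2 adm psi) (descend phi)
       `&` l @^-1` [set t]) (proj p) <-> phi p != 0 /\ plab p = t.
  rewrite fiber -[phi (repr _)]/(descend phi (proj p)) descendE.
  by split => -[p0 <-]; rewrite -(lE p0).
apply: (@nodal_count_label R (quotient_surface g1 g2 adm psi) (descend phi) l
  a b).
- move=> t; rewrite /open /= /quotient_open.
  have -> : \pi_Q @^-1` (off_nodal_set
      (M := quotient_surface g1 g2 adm psi) (descend phi) `&` l @^-1` [set t]) =
      [set p | phi p != 0 /\ plab p = t].
    by apply/seteqP; split => p /fiberp.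
  by rewrite fiberE; apply: bigcup_open => -[i j] _; exact: cell_open.
- move=> t; apply: (@connected_star _ _ (proj (base t))) => x /fiber[x0 xt].
  exists (proj @` cell A1 s1 A2 s2 (ix (repr (x : Q))) (iy (repr (x : Q)))).
  have [x1 x2] := (phi_neq0 _).1 x0.
  split.
  + apply: connected_continuous_connected; first exact: cell_connected.
    by apply: continuous_subspaceT => p; exact: plane_proj_continuous.
  + move=> _ [p [c1 c2] <-]; apply/fiberp; split.
      by apply/phi_neq0; split;
        [exact: between_off_grid c1|exact: between_off_grid c2].
    by rewrite /plab /ix /iy (between_floor c1) (between_floor c2).
  + by exists (repr (x : Q)); [split|exact: plane_proj_repr].
  + have [q [cq oq]] := lab_base x0.
    by exists q => //; rewrite -xt; exact: plane_proj_eq.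
apply/seteqP; split => [_ [x [_ x0] <-]|t /lab_onto[p [p0 <-]]].
  exact: lab_bound.
exists (proj p); last exact: lE.
by split => //; rewrite /= descendE.
Qed.

End Labels.
End Quotient.
(** * Eigenvalues of products *)

Section Eigen.
Variable R : realType.

Lemma is_derive_scale (c t d : R) (u : R -> R) :
  is_derive t (1 : R) u d -> is_derive t (1 : R) (fun x => c * u x) (c * d).
Proof. by move=> du; exact: (is_deriveZ c du). Qed.

Lemma is_derive_scale_arg (c t d : R) (u : R -> R) :
  is_derive (c * t) (1 : R) u d ->
  is_derive t (1 : R) (fun x => u (c * x)) (c * d).
Proof.
move=> du; rewrite mulrC; apply: (is_derive1_comp du).
by have := is_derive_scale c (is_derive_id t (1 : R)); rewrite mulr1.
Qed.

(** The equation [u'' = - omega ^ 2 * u], with the derivative named so that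
    both differentiations are explicit. *)
Definition oscillates (omega : R) (u : R -> R) : Prop :=
  exists u' : R -> R, forall t, is_derive t (1 : R) u (u' t) /\
    is_derive t (1 : R) u' (- omega ^+ 2 * u t).

Lemma oscillates_sin omega : oscillates omega (fun t => sin (omega * t)).
Proof.
exists (fun t => omega * cos (omega * t)) => t; split.
  exact: (is_derive_scale_arg (is_derive_sin _)).
have := is_derive_scale omega (is_derive_scale_arg (is_derive_cos (omega * t))).
by move=> h; apply: (is_derive_eq h); ring.
Qed.

Lemma oscillates_cos omega : oscillates omega (fun t => cos (omega * t)).
Proof.
exists (fun t => omega * - sin (omega * t)) => t; split.
  exact: (is_derive_scale_arg (is_derive_cos _)).
have := is_derive_scale (- omega) (is_derive_scale_arg (is_derive_sin (omega
  * t))).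
have -> : (fun x => - omega * sin (omega * x)) = (fun x =>
  omega * - sin (omega * x)).
  by apply/funext => x; ring.
by move=> h; apply: (is_derive_eq h); ring.
Qed.

Lemma oscillates_derive2 omega u c t : oscillates omega u ->
  derive1n 2 (fun x => c * u x) t = - omega ^+ 2 * (c * u t).
Proof.
move=> [u' uu']; rewrite derive1nS derive1n1.
have -> : derive1 (fun x => c * u x) = (fun x => c * u' x).
  apply/funext => s; rewrite derive1E.
  by have [/(is_derive_scale c) du _] := uu' s; exact: derive_val.
rewrite derive1E; have [_ /(is_derive_scale c) du] := uu' t.
by rewrite (@derive_val _ _ _ _ _ _ _ du); ring.
Qed.

(** The point where the product does not vanish makes the eigenvalue unique. *)
Lemma eigenpair_product (M : surface R) (f : space M -> R) (u v : R -> R)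
    (omega eta : R) :
  (forall p, f (chart M p) = u p.1 * v p.2) ->
  oscillates omega u -> oscillates eta v ->
  (exists2 p, (chart M @^-1` pts M)° p & u p.1 * v p.2 != 0) ->
  forall lambda, eigenpair f lambda <-> lambda = omega ^+ 2 + eta ^+ 2.
Proof.
move=> fE ou ov [p0 ip0 nz] lambda.
have lapE p : laplacian f p = (omega ^+ 2 + eta ^+ 2) * f (chart M p).
  rewrite /laplacian.
  have -> : (fun t => f (chart M (t, p.2))) = (fun t => v p.2 * u t).
    by apply/funext => t; rewrite fE mulrC.
  have -> : (fun t => f (chart M (p.1, t))) = (fun t => u p.1 * v t).
    by apply/funext => t; rewrite fE.
  by rewrite (oscillates_derive2 _ _ ou) (oscillates_derive2 _ _ ov) fE; ring.
split=> [[_ /(_ p0 ip0)]|->].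
  by rewrite lapE => /mulIf -> //; rewrite fE.
split; last by move=> p _; exact: lapE.
exists (chart M p0); last by rewrite fE.
exact: interior_subset ip0.
Qed.
End Eigen.

(** * Nodal lines and cells of trigonometric products *)

Section Waves.
Variable R : realType.
Implicit Types (t x : R) (k z : int).

Lemma cos_wave_neq0 k t :
  cos (2 * pi * k%:~R * t) != 0 :> R <->
  off_grid ((2 * `|k|)%N%:R * t + 2^-1).
Proof.
have -> : cos (2 * pi * k%:~R * t) = cos (pi * ((2 * `|k|)%N%:R * t)).
  rewrite natrM; case: k => n; first by rewrite -pmulrn; congr cos; ring.
  rewrite NegzE mulrNz -pmulrn abszN absz_nat -cosN; congr cos; ring.
exact: cos_pi_neq0.
Qed.

Lemma sin_wave_neq0 k t :
  sin (2 * pi * k%:~R * t) != 0 :> R <->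
  off_grid ((2 * `|k|)%N%:R * t + 0).
Proof.
rewrite addr0 -sin_pi_neq0 natrM.
case: k => n.
  by rewrite -pmulrn absz_nat;
    have -> : 2 * pi * n%:R * t = pi * (2 * n%:R * t) by ring.
rewrite NegzE mulrNz -pmulrn abszN absz_nat.
have -> : 2 * pi * - n.+1%:R * t = - (pi * (2 * n.+1%:R * t)) by ring.
by rewrite sinN oppr_eq0.
Qed.

End Waves.

Section Residues.
Variables (K : nat) (i : int).
Hypothesis i0 : K = 0%N -> i = 0.

Lemma absz_modE : `|(i %% K)%Z|%N = (i %% K)%Z :> int.
Proof.
have [K0|K0] := posnP K; first by rewrite i0// mod0z.
by rewrite gez0_abs// modz_ge0// eqz_nat -lt0n.
Qed.

Lemma absz_mod_lt : (`|(i %% K)%Z| < K + (K == 0))%N.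
Proof.
have [K0|K0] := posnP K; first by rewrite i0// K0.
by rewrite addn0 -ltz_nat absz_modE ltz_pmod.
Qed.

End Residues.

Lemma absz_mod_small (k K : nat) : (k < K + (K == 0))%N -> `|(k %% K)%Z|%N = k.
Proof.
case: K => [|K] /=; first by case: k.
by rewrite addn0 => kK; rewrite modz_small.
Qed.

Lemma modzBr (i : int) (K : nat) : ((i - K%:Z) %% K)%Z = (i %% K)%Z.
Proof. by rewrite addrC -mulN1r modzMDl. Qed.

(** One coordinate of a grid.  The grid lines are the [x] with [A * x + s] an
    integer, where [A = K * c]: there are [K] of them per period [1 / c].  The
    degenerate case [K = 0] with [s = 2^-1] describes a constant nonzero
    factor, which has no grid line and only the cell of index [0]; the
    hypothesis [s_half] excludes the factor that vanishes identically. *)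
Section Axis.
Variable R : realType.
Variables (K : nat) (c s : R).
Hypothesis c_gt0 : 0 < c.
Hypothesis s_half : K = 0%N -> s = 2^-1.

Local Notation A := (K%:R * c).

(** The midpoint of the cell of index [i]; for [K = 0] division by zero gives
    [0], which lies in the only cell. *)
Definition center (i : int) : R := (i%:~R + 2^-1 - s) / A.

Lemma index_eq0 (x : R) : K = 0%N -> Num.floor (A * x + s) = 0.
Proof.
move=> K0; apply: between_floor; rewrite /between K0 !mul0r add0r s_half//.
by apply/andP; split; lra.
Qed.

Lemma between_center i : (K = 0%N -> i = 0) -> between i (A * center i + s).
Proof.
move=> i0; have -> : A * center i + s = i%:~R + 2^-1; last first.
  by rewrite /between; apply/andP; split; lra.
rewrite /center; have [K0|K0] := posnP K.
  by rewrite i0// s_half// K0 !mul0r mulr0z.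
have A0 : A != 0 by rewrite mulf_neq0 ?pnatr_eq0 -?lt0n// gt_eqF.
by rewrite mulrC divfK// subrK.
Qed.

Lemma index_center i : (K = 0%N -> i = 0) -> Num.floor (A * center i + s) = i.
Proof. by move=> /between_center/between_floor. Qed.

Lemma index_shift x : off_grid (A * x + s) ->
  Num.floor (A * (x + c^-1) + s) = Num.floor (A * x + s) + K.
Proof.
move=> xs; rewrite -floorDz//; congr Num.floor.
rewrite -pmulrn; field; exact: lt0r_neq0.
Qed.

Lemma center_mod i : (K = 0%N -> i = 0) ->
  exists z : int, center i = center (i %% K)%Z + z%:~R * c^-1.
Proof.
move=> i0; have [K0|K0] := posnP K.
  by exists 0; rewrite i0// mod0z mulr0z mul0r addr0.
exists (i %/ K)%Z; rewrite {1}(divz_eq i K) /center intrD intrM -pmulrn.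
by field; rewrite pnatr_eq0 -lt0n K0 lt0r_neq0.
Qed.

Lemma center_reflect (e i : int) : e%:~R = 2 * s - 1 ->
  - center i = center (e - i).
Proof. by move=> eE; rewrite /center intrD mulrNz eE -mulNr; congr (_ / _);
  lra. Qed.

End Axis.

(** * Nodal counts of the rectangles *)

Lemma rectangle_nodal_data (R : realType) (alpha : R) : 0 < alpha ->
  has_nodal_data (rectangle alpha) alpha (pi ^+ 2) (fun m n => `|m| * `|n|)%N.
Proof.
move=> a0; split; first by rewrite exprn_gt0 ?pi_gt0.
move=> m n [m1 n1].
have [h hE] : exists h : nat, m = h.+1 by case: m m1 => [[|h]|h]// _; exists h.
have [k kE] : exists k : nat, n = k.+1 by case: n n1 => [[|k]|k]// _; exists k.
subst m n; clear m1 n1.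
pose A1 : R := h.+1%:R * 1; pose A2 : R := k.+1%:R * alpha.
have waveE p : eigfun (rectangle alpha) h.+1 k.+1 p =
    sin (pi * (A1 * p.1 + 0)) * sin (pi * (A2 * p.2 + 0)).
  by rewrite /= invrK /A1 /A2 -!pmulrn !addr0 mulr1; congr (sin _ * sin _);
    ring.
have nzE p : eigfun (rectangle alpha) h.+1 k.+1 p != 0 <->
    off_grid (A1 * p.1 + 0) /\ off_grid (A2 * p.2 + 0).
  by rewrite waveE mulf_eq0 negb_or -!sin_pi_neq0; split => [/andP|] [-> ->].
have cell_pts (i j : nat) : (i < h.+1)%N -> (j < k.+1)%N ->
    cell A1 0 A2 0 i j `<=` pts (rectangle alpha).
  move=> ih jk p [/andP[i0 i1] /andP[j0 j1]]; rewrite /=.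
  have ih1 : i%:R + 1 <= h.+1%:R :> R by rewrite natr1 ler_nat.
  have jk1 : j%:R + 1 <= k.+1%:R :> R by rewrite natr1 ler_nat.
  have hh : 0 < h.+1%:R :> R by rewrite ltr0n.
  have kk : 0 < k.+1%:R :> R by rewrite ltr0n.
  have i00 := ler0n R i; have j00 := ler0n R j.
  rewrite -!pmulrn in i0 i1 j0 j1.
  move: i0 i1 j0 j1; rewrite /A1 /A2 !addr0 mulr1 => i0 i1 j0 j1.
  split; apply/andP; split.
  - by rewrite -(pmulr_rge0 _ hh); lra.
  - by rewrite -(ler_pM2l hh); lra.
  - by rewrite -(pmulr_rge0 _ (mulr_gt0 kk a0)); lra.
  - by rewrite -(ler_pM2l (mulr_gt0 kk a0)) mulfK ?gt_eqF//; lra.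
have centerP (i j : nat) :
    cell A1 0 A2 0 i j (center h.+1 1 0 i, center k.+1 alpha 0 j).
  by split; apply: between_center.
split=> [lambda|_ v].
  have -> : pi ^+ 2 * energy alpha h.+1 k.+1 = (pi * A1) ^+ 2 + (pi * A2) ^+ 2.
    by rewrite /energy -!pmulrn /A1 /A2; ring.
  apply: (@eigenpair_product _ _ _ (fun t => sin (pi * A1 * t))
            (fun t => sin (pi * A2 * t))).
  - by move=> p; rewrite waveE !addr0 !mulrA.
  - exact: oscillates_sin.
  - exact: oscillates_sin.
  exists (center h.+1 1 0 0%N, center k.+1 alpha 0 0%N).
    have sub : cell A1 0 A2 0 0%N 0%N `<=` (pts (rectangle alpha))°.
      by rewrite -open_subsetE; [exact: (@cell_pts 0%N 0%N)|exact: cell_open].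
    exact: sub (centerP 0%N 0%N).
  have [/between_off_grid c1 /between_off_grid c2] := centerP 0%N 0%N.
  have := (nzE _).2 (conj c1 c2); rewrite waveE.
  by rewrite !addr0 !mulrA.
pose l (p : R * R) := (`|Num.floor (A1 * p.1 + 0)|%N, `|Num.floor (A2 * p.2 +
  0)|%N).
have lcell (i j : nat) p : cell A1 0 A2 0 i j p -> l p = (i, j).
  by case=> /between_floor e1 /between_floor e2; rewrite /l e1 e2 !absz_nat.
set U := off_nodal_set (eigfun (rectangle alpha) h.+1 k.+1).
have cellU (i j : nat) : (i < h.+1)%N -> (j < k.+1)%N ->
    cell A1 0 A2 0 i j `<=` U.
  move=> ih jk p pc; split; first exact: cell_pts pc.
  by case: pc => /between_off_grid c1 /between_off_grid c2; apply/nzE.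
have Ucell p : U p -> [/\ ((l p).1 < h.+1)%N, ((l p).2 < k.+1)%N &
    cell A1 0 A2 0 (l p).1 (l p).2 p].
  move=> [[/andP[x0 x1] /andP[y0 y1] ] /nzE[z1 z2] ].
  have bound (A x : R) n : 0 <= A * x + 0 -> A * x + 0 <= n%:R ->
    off_grid (A * x + 0) ->
      (`|Num.floor (A * x + 0)| < n)%N /\ `|Num.floor (A * x + 0)|%N =
        Num.floor (A * x + 0) :> int.
    move=> t0 tn /andP[lo hi].
    have f0 : 0 <= Num.floor (A * x + 0) by rewrite floor_ge0.
    split; last by rewrite gez0_abs.
    rewrite -ltz_nat gez0_abs// -(ltr_int R) -pmulrn.
    exact: lt_le_trans lo tn.
  have [|||b1 e1] := bound A1 p.1 h.+1 => //.
  - by rewrite /A1; have : 0 <= h.+1%:R :> R by []; nra.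
  - by rewrite /A1 addr0 mulr1 ler_piMr.
  have [|||b2 e2] := bound A2 p.2 k.+1 => //.
  - by rewrite addr0 /A2 !mulr_ge0// ltW.
  - by rewrite addr0 /A2 -mulrA ler_piMr// mulrC -ler_pdivlMr// div1r.
  by split => //; split; rewrite /= ?e1 ?e2.
have fiberE t : U `&` l @^-1` [set t] =
    if (t.1 < h.+1)%N && (t.2 < k.+1)%N then cell A1 0 A2 0 t.1 t.2 else set0.
  apply/seteqP; split => [p [/Ucell[b1 b2 pc] /= <-]|p]; first by rewrite b1 b2.
  by case: ifP => // /andP[b1 b2] pc; split;
    [exact: (cellU _ _ b1 b2)|rewrite /= (lcell _ _ _ pc); case: (t)].
apply: (@nodal_count_label R (rectangle alpha) _ l h.+1 k.+1).
- by move=> t; rewrite fiberE; case: ifP => _; [exact: cell_open|exact: open0].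
- by move=> t; rewrite fiberE; case: ifP => _;
  [exact: cell_connected|exact: connected0].
apply/seteqP; split => [_ [p /Ucell[b1 b2 _] <-]//|[i j] [/= ih jk]].
exists (center h.+1 1 0 i, center k.+1 alpha 0 j); last exact: lcell.
exact: (cellU i j).
Qed.

(** * Nodal counts of the tori *)

Section Orbits.
Variables (R : realType) (g1 g2 : R * R -> R * R).
Local Notation orb := (same_orbit g1 g2).

Lemma same_orbit_g1 p : orb p (g1 p).
Proof. by apply/asboolP; apply: rst_step; left. Qed.

Lemma same_orbit_g2 p : orb p (g2 p).
Proof. by apply/asboolP; apply: rst_step; right. Qed.

Lemma same_orbit_int (f : int -> R * R) :
  (forall z, orb (f z) (f (z + 1))) -> forall z z', orb (f z) (f z').
Proof.
move=> step.
have up z n : orb (f z) (f (z + n%:Z)).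
  elim: n => [|n ih]; first by rewrite addr0; exact: same_orbit_refl.
  by apply: same_orbit_trans ih _; rewrite -addn1 PoszD addrA; exact: step.
have from0 z : orb (f 0) (f z).
  case: z => n; first by have := up 0 n; rewrite add0r.
  by rewrite same_orbit_sym; have := up (Negz n) n.+1; rewrite NegzE addNr.
by move=> z z'; apply: same_orbit_trans (from0 z'); rewrite same_orbit_sym.
Qed.

End Orbits.

Lemma sin_wave_periodic (R : realType) (k : int) (t : R) :
  sin (2 * pi * k%:~R * (t + 1)) = sin (2 * pi * k%:~R * t).
Proof.
have -> : 2 * pi * k%:~R * (t + 1) = 2 * pi * k%:~R * t + pi * (2 * k)%:~R.
  by rewrite intrM; ring.
by have [-> _] := sincosD_int (2 * pi * k%:~R * t) (2 * k);
  rewrite abszM oddM mul1r.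
Qed.

Lemma cos_wave_periodic (R : realType) (k : int) (t : R) :
  cos (2 * pi * k%:~R * (t + 1)) = cos (2 * pi * k%:~R * t).
Proof.
have -> : 2 * pi * k%:~R * (t + 1) = 2 * pi * k%:~R * t + pi * (2 * k)%:~R.
  by rewrite intrM; ring.
by have [_ ->] := sincosD_int (2 * pi * k%:~R * t) (2 * k);
  rewrite abszM oddM mul1r.
Qed.

Definition wave (R : realType) (k : int) (t : R) : R :=
  trig k (2 * pi * k%:~R * t).

Definition phase (R : realType) (k : int) : R := if 0 <= k then 2^-1 else 0.

Lemma wave_periodic (R : realType) k (t : R) : wave k (t + 1) = wave k t.
Proof.
by rewrite /wave /trig; case: ifP => _;
  [exact: cos_wave_periodic|exact: sin_wave_periodic].
Qed.

Lemma wave_neq0 (R : realType) k (t : R) : wave k t != 0 <->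
  off_grid ((2 * `|k|)%N%:R * t + phase R k).
Proof.
by rewrite /wave /trig /phase; case: ifP => _;
  [exact: cos_wave_neq0|exact: sin_wave_neq0].
Qed.

Lemma oscillates_wave (R : realType) k (c : R) :
  oscillates (2 * pi * k%:~R * c) (fun t => wave k (t * c)).
Proof.
rewrite /wave /trig; case: (0 <= k).
  have -> : (fun t => cos (2 * pi * k%:~R * (t * c))) =
      (fun t => cos (2 * pi * k%:~R * c * t)) by apply/funext => t;
        congr cos; ring.
  exact: oscillates_cos.
have -> : (fun t => sin (2 * pi * k%:~R * (t * c))) =
    (fun t => sin (2 * pi * k%:~R * c * t)) by apply/funext => t; congr sin;
      ring.
exact: oscillates_sin.
Qed.

Lemma phase_half (R : realType) k : (2 * `|k|)%N = 0%N -> phase R k = 2^-1.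
Proof. by move=> k0; rewrite /phase; have -> : k = 0 by lia. Qed.

(** On each axis the cells of the plane are permuted by a translation by the
    [K] indices of one period, so that the residue modulo [K] is a complete
    invariant of the orbit; for [K = 0] this is the single index [0]. *)
Lemma torus_nodal_data (R : realType) (alpha : R) : 0 < alpha ->
  has_nodal_data (torus alpha) alpha (4 * pi ^+ 2)
    (fun m n => (2 * `|m| + (m == 0)) * (2 * `|n| + (n == 0)))%N.
Proof.
move=> a0; split; first by rewrite mulr_gt0// exprn_gt0 ?pi_gt0.
move=> m n _.
set K1 := (2 * `|m|)%N; set K2 := (2 * `|n|)%N.
pose s1 := phase R m; pose s2 := phase R n.
have half1 : K1 = 0%N -> s1 = 2^-1 := @phase_half R m.
have half2 : K2 = 0%N -> s2 = 2^-1 := @phase_half R n.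
pose A1 : R := K1%:R * 1; pose A2 : R := K2%:R * alpha.
pose phi (p : R * R) := wave m (p.1 * 1) * wave n (p.2 * alpha).
pose g1 (p : R * R) := (p.1 + 1, p.2);
  pose g2 (p : R * R) := (p.1, p.2 + alpha^-1).
have phi1 p : phi (g1 p) = phi p by rewrite /phi /= !mulr1 wave_periodic.
have phi2 p : phi (g2 p) = phi p.
  by rewrite /phi /= mulrDl mulVf ?gt_eqF// wave_periodic.
have eigE : eigfun (torus alpha) m n = @descend R g1 g2 phi.
  rewrite /= ; congr descend; apply/funext => p.
  by rewrite /phi /wave invrK mulr1 [p.2 * _]mulrC !mulrA;
    congr (_ * trig _ _); ring.
have nzE p : phi p != 0 <-> off_grid (A1 * p.1 + s1) /\ off_grid (A2 * p.2 +
  s2).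
  rewrite /phi mulf_eq0 negb_or /A1 /A2 !mulr1 [p.2 * _]mulrC -mulrA
    -!wave_neq0.
  by split => [/andP|] [-> ->].
pose ctr (i j : int) := (center K1 1 s1 i, center K2 alpha s2 j).
have one0 := @ltr01 R.
have ctrP i j : (K1 = 0%N -> i = 0) -> (K2 = 0%N -> j = 0) ->
  cell A1 s1 A2 s2 i j (ctr i j).
  by move=> i0 j0; split; apply: between_center.
have cell_nz i j p : cell A1 s1 A2 s2 i j p -> phi p != 0.
  by case=> /between_off_grid h1 /between_off_grid h2; apply/nzE.
have c00 : phi (ctr 0 0) != 0 by apply: (cell_nz 0 0); apply: ctrP.
split=> [lambda|_ v]; rewrite eigE.
  have -> : 4 * pi ^+ 2 * energy alpha m n =
      (2 * pi * m%:~R * 1) ^+ 2 + (2 * pi * n%:~R * alpha) ^+ 2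
        by rewrite /energy; ring.
  apply: (@eigenpair_product _ (torus alpha) _ (fun t => wave m (t * 1))
            (fun t => wave n (t * alpha))).
  - by move=> p; exact: (descendE phi1 phi2).
  - exact: oscillates_wave.
  - exact: oscillates_wave.
  by exists (ctr 0 0) => //; rewrite /= preimage_setT interiorT.
have eqb (k : int) : ((k == 0) = (2 * `|k| == 0)%N)
  by rewrite muln_eq0 /= absz_eq0.
rewrite !eqb -/K1 -/K2.
pose lab (i j : int) := (`|(i %% K1)%Z|%N, `|(j %% K2)%Z|%N).
apply: (@nodal_count_grid _ g1 g2 phi phi1 phi2 A1 s1 A2 s2 lab _ _
          (fun t => ctr t.1 t.2) nzE).
- move=> p /nzE[h1 h2]; rewrite /lab /=.
  by have := index_shift one0 h1; rewrite invr1 => ->; rewrite modzDr.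
- move=> p /nzE[h1 h2]; rewrite /lab /=.
  by rewrite (index_shift a0 h2) modzDr.
- move=> p /nzE[h1 h2]; set i := Num.floor _; set j := Num.floor _.
  have i0 : K1 = 0%N -> i = 0 := @index_eq0 _ _ 1 _ half1 _.
  have j0 : K2 = 0%N -> j = 0 := @index_eq0 _ _ alpha _ half2 _.
  exists (ctr i j); split; first exact: ctrP.
  rewrite /lab /= !absz_modE// /ctr.
  have [z1 ->] := center_mod s1 one0 i0; have [z2 ->] := center_mod s2 a0 j0.
  set x := center K1 1 s1 _; set y := center K2 alpha s2 _.
  apply: (@same_orbit_trans _ _ _ (x, y + z2%:~R * alpha^-1)).
    have := @same_orbit_int _ g1 g2 (fun z => (x + z%:~R * 1^-1, y +
      z2%:~R * alpha^-1)).
    move=> /(_ _ z1 0); rewrite mulr0z mul0r addr0; apply => z.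
    by rewrite intrD mulrDl invr1 !mulr1 addrA; exact: same_orbit_g1.
  have := @same_orbit_int _ g1 g2 (fun z => (x, y + z%:~R * alpha^-1)).
  move=> /(_ _ z2 0); rewrite mulr0z mul0r addr0; apply => z.
  by rewrite intrD mulrDl mul1r addrA; exact: same_orbit_g2.
- by move=> p _; split; apply: absz_mod_lt; apply: index_eq0.
move=> [i j] [/= iK jK]; exists (ctr i j).
have v1 : K1 = 0%N -> i%:Z = 0 by move=> K0; move: iK; rewrite K0; case: (i).
have v2 : K2 = 0%N -> j%:Z = 0 by move=> K0; move: jK; rewrite K0; case: (j).
split; first by apply: (cell_nz i j); apply: ctrP.
by rewrite /lab /= !index_center// !absz_mod_small.
Qed.

(** * Nodal counts of the Klein bottles *)

Definition klein_nu (m n : int) : nat :=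
  (2 * (`|m| * `|n|) + (m == 0) * (`|n| + 1) + `|m| * (n == 0))%N.

Section Klein.
Variables (R : realType) (alpha : R) (m n : int).
Hypothesis a0 : 0 < alpha.
Hypothesis adm : if odd `|m|%N then n <> 0 else 0 <= n.

Let K1 := (2 * `|m|)%N.
Let K2 := (2 * `|n|)%N.
Let s2 : R := if odd `|m|%N then 0 else 2^-1.
Let A1 : R := K1%:R * 1.
Let A2 : R := K2%:R * alpha.
Let g1 (p : R * R) := (p.1, p.2 + alpha^-1).
Let g2 (p : R * R) := (p.1 + 2^-1, - p.2).
Let fx (t : R) := cos (2 * pi * m%:~R * (t * 1)).
Let fy (t : R) := if odd `|m|%N then sin (2 * pi * n%:~R * (t * alpha))
                  else cos (2 * pi * n%:~R * (t * alpha)).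
Let phi (p : R * R) := fx p.1 * fy p.2.
Let ctr (i j : int) : R * R := (center K1 1 2^-1 i, center K2 alpha s2 j).
(* The reflection [y -> - y] sends the [j]-th cell to the cell [e - j]. *)
Let e : int := if odd `|m|%N then -1 else 0.
Local Notation one0 := (@ltr01 R).

Let half2 : K2 = 0%N -> s2 = 2^-1.
Proof. by rewrite /s2; case: ifP adm => // _ n0 k0; exfalso; lia. Qed.

Let eE : e%:~R = 2 * s2 - 1.
Proof.
by rewrite /e /s2; case: ifP => _; rewrite ?mulrNz ?mulr0z; lra.
Qed.

Let phi1 p : phi (g1 p) = phi p.
Proof.
rewrite /phi /fy /g1 /= [(p.2 + _) * _]mulrDl mulVf ?gt_eqF//.
by rewrite sin_wave_periodic cos_wave_periodic.
Qed.

Let phi2 p : phi (g2 p) = phi p.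
Proof.
rewrite /phi /fx /fy /g2 /= mulNr mulrN cosN sinN !mulr1.
have -> : 2 * pi * m%:~R * (p.1 + 2^-1) = 2 * pi * m%:~R * p.1 +
  pi * m%:~R by field.
have [_ ->] := sincosD_int (2 * pi * m%:~R * p.1) m.
by case: ifP => _; rewrite ?mul1r// mulN1r mulrNN.
Qed.

Let eigE : eigfun (klein_bottle alpha) m n = @descend R g1 g2 phi.
Proof.
rewrite /=; congr descend; apply/funext => p.
rewrite /phi /fx /fy invrK mulr1.
by have -> : 2 * pi * n%:~R * p.2 * alpha = 2 * pi * n%:~R * (p.2 * alpha)
  by ring.
Qed.

Let nzE p : phi p != 0 <->
  off_grid (A1 * p.1 + 2^-1) /\ off_grid (A2 * p.2 + s2).
Proof.
have -> : A1 * p.1 + 2^-1 = K1%:R * (p.1 * 1) + 2^-1 by rewrite /A1; ring.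
have -> : A2 * p.2 + s2 = K2%:R * (p.2 * alpha) + s2 by rewrite /A2; ring.
rewrite /phi mulf_eq0 negb_or -cos_wave_neq0.
suff H : (fy p.2 != 0) <-> off_grid (K2%:R * (p.2 * alpha) + s2).
  by split=> [/andP[-> /H]|[-> /H ->]].
by rewrite /fy /s2; case: ifP => _; [exact: sin_wave_neq0|exact: cos_wave_neq0].
Qed.

Let cell_nz i j p : cell A1 2^-1 A2 s2 i j p -> phi p != 0.
Proof. by case=> /between_off_grid h1 /between_off_grid h2; apply/nzE. Qed.

Let ctrP i j : (K1 = 0%N -> i = 0) -> (K2 = 0%N -> j = 0) ->
  cell A1 2^-1 A2 s2 i j (ctr i j).
Proof. by move=> i0 j0; split; apply: between_center. Qed.

Lemma klein_eigenpair lambda :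
  eigenpair (eigfun (klein_bottle alpha) m n) lambda <->
  lambda = 4 * pi ^+ 2 * energy alpha m n.
Proof.
have -> : 4 * pi ^+ 2 * energy alpha m n =
    (2 * pi * m%:~R * 1) ^+ 2 + (2 * pi * n%:~R * alpha) ^+ 2.
  by rewrite /energy; ring.
rewrite eigE; apply: (@eigenpair_product _ (klein_bottle alpha) _ fx fy).
- by move=> p; exact: (descendE phi1 phi2).
- have -> : fx = (fun t => cos (2 * pi * m%:~R * 1 * t)).
    by apply/funext => t; congr cos; ring.
  exact: oscillates_cos.
- rewrite /fy; case: (odd _).
    have -> : (fun t => sin (2 * pi * n%:~R * (t * alpha))) =
        (fun t => sin (2 * pi * n%:~R * alpha * t)).
      by apply/funext => t; congr sin; ring.
    exact: oscillates_sin.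
  have -> : (fun t => cos (2 * pi * n%:~R * (t * alpha))) =
      (fun t => cos (2 * pi * n%:~R * alpha * t)).
    by apply/funext => t; congr cos; ring.
  exact: oscillates_cos.
exists (ctr 0 0); first by rewrite /= preimage_setT interiorT.
by apply: (cell_nz (i := 0) (j := 0)); apply: ctrP.
Qed.

Let orbit_y x y z : same_orbit g1 g2 (x, y + z%:~R * alpha^-1) (x, y).
Proof.
have := @same_orbit_int _ g1 g2 (fun z => (x, y + z%:~R * alpha^-1)).
move=> /(_ _ z 0); rewrite mulr0z mul0r addr0; apply => k.
by rewrite intrD mulrDl mul1r addrA; exact: same_orbit_g1.
Qed.

Let orbit_x x y (z : int) : same_orbit g1 g2 (x + z%:~R / 2, y)
  (x, if odd `|z|%N then - y else y).
Proof.
pose y' := if odd `|z|%N then - y else y.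
have := @same_orbit_int _ g1 g2 (fun k : int =>
  (x + k%:~R / 2, if odd `|k|%N then - y' else y')).
move=> /(_ _ z 0); rewrite mulr0z mul0r addr0 /=.
have -> : (if odd `|z|%N then - y' else y') = y.
  by rewrite /y'; case: (odd _); rewrite ?opprK.
apply => k.
have -> : odd `|(k + 1)%R|%N = ~~ odd `|k|%N by lia.
have -> : x + (k + 1)%:~R / 2 = x + k%:~R / 2 + 2^-1 by rewrite intrD; ring.
have := same_orbit_g2 g1 g2 (x + k%:~R / 2, if odd `|k|%N then - y' else y').
by rewrite /g2 /=; case: (odd _); rewrite ?opprK.
Qed.

Let floor_g2y (y : R) : off_grid (A2 * y + s2) ->
  Num.floor (A2 * - y + s2) = e - Num.floor (A2 * y + s2).
Proof.
move=> h; have -> : A2 * - y + s2 = (e + 1)%:~R - (A2 * y + s2).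
  by rewrite intrD eE; ring.
by rewrite floor_reflect// addrK.
Qed.

(** The glide reflection moves the [i]-th column of cells to the column
    [i + `|m|], reflecting it.  So every cell can be brought to the columns
    [0 <= i < `|m|], and the vertical index then matters modulo [K2] only; the
    parity of the number of glides needed tells whether it is reflected. *)
Lemma klein_nodal_count_cells v : m != 0 ->
  nodal_count (eigfun (klein_bottle alpha) m n) v <->
  v = (`|m| * (K2 + (K2 == 0)))%N.
Proof.
move=> m0; rewrite eigE.
pose h := `|m|%N; have h0 : (0 < h)%N by rewrite /h absz_gt0.
have h0' : h%:Z != 0 by rewrite eqz_nat -lt0n.
pose flip (i j : int) : int := if odd `|(i %/ h)%Z|%N then e - j else j.
pose lab (i j : int) := (`|(i %% h)%Z|%N, `|(flip i j %% K2)%Z|%N).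
have K1_0 (i : int) : K1 = 0%N -> i = 0 by rewrite /K1 -/h => hh; exfalso; lia.
have flip0 (i j : int) : (K2 = 0%N -> j = 0) -> K2 = 0%N -> flip i j = 0.
  move=> j0 k0; rewrite /flip j0// subr0; suff -> : e = 0 by rewrite if_same.
  by apply/eqP; rewrite -(intr_eq0 R) eE half2//; apply/eqP; lra.
apply: (@nodal_count_grid _ g1 g2 phi phi1 phi2 A1 2^-1 A2 s2 lab _ _
          (fun t => ctr t.1 t.2) nzE).
- move=> p /nzE[_ h2]; rewrite /lab /flip /= (index_shift a0 h2).
  congr (_, _); case: ifP => _; last by rewrite modzDr.
  by rewrite opprD addrA modzBr.
- move=> p /nzE[h1 h2]; rewrite /lab /flip /= floor_g2y//.
  have -> : Num.floor (A1 * (p.1 + 2^-1) + 2^-1) = Num.floor (A1 * p.1 +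
    2^-1) + h.
    by rewrite -floorDz//; congr Num.floor; rewrite /A1 /K1 natrM -pmulrn;
      field.
  rewrite modzDr divzDr// divzz h0' /=.
  have -> : odd `|((Num.floor (A1 * p.1 + 2^-1) %/ h)%Z + 1)%R|%N =
     ~~ odd `|(Num.floor (A1 * p.1 + 2^-1) %/ h)%Z|%N by lia.
  by case: (odd _) => //=; rewrite subKr.
- move=> p /nzE[h1 h2]; set i := Num.floor _; set j := Num.floor _.
  have j0 : K2 = 0%N -> j = 0 := @index_eq0 _ _ alpha _ half2 _.
  exists (ctr i j); split; first by apply: ctrP => //; exact: K1_0.
  have f0 : K2 = 0%N -> flip i j = 0 by exact: flip0.
  rewrite /lab /=.
  have -> : `|(i %% h)%Z|%N = (i %% h)%Z :> int by rewrite gez0_abs// modz_ge0.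
  have -> : `|(flip i j %% K2)%Z|%N = (flip i j %% K2)%Z :> int.
    exact: absz_modE.
  rewrite /ctr.
  have -> : center K1 1 2^-1 i = center K1 1 2^-1 (i %% h)%Z +
    (i %/ h)%Z%:~R / 2 :> R.
    rewrite {1}(divz_eq i h) /center intrD intrM -pmulrn /K1 -/h natrM.
    by field; rewrite pnatr_eq0 -lt0n.
  apply: same_orbit_trans (orbit_x _ _ _) _.
  have -> : (if odd `|(i %/ h)%Z|%N then - center K2 alpha s2 j else center
    K2 alpha s2 j)
      = center K2 alpha s2 (flip i j).
    by rewrite /flip; case: ifP => // _; rewrite (center_reflect K2 alpha _ eE).
  have [z ->] := center_mod s2 a0 f0.
  exact: orbit_y.
- move=> p _; split; rewrite /lab /=.
    by rewrite -ltz_nat gez0_abs ?modz_ge0// ltz_pmod// ltz_nat.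
  by apply: absz_mod_lt; apply: flip0; exact: index_eq0.
move=> [i j] [/= iK jK]; exists (ctr i j).
have v2 : K2 = 0%N -> j%:Z = 0 by move=> K0; move: jK; rewrite K0; case: (j).
split; first by apply: (cell_nz (i := i) (j := j)); apply: ctrP => //;
  exact: K1_0.
rewrite /lab /= !index_center//; last exact: K1_0.
rewrite absz_mod_small; last by rewrite (leq_trans iK)// leq_addr.
by rewrite /flip divz_small ?ltz_nat// absz_mod_small.
Qed.

(** For [m = 0] the cells are horizontal bands, and the glide reflection
    identifies the bands [j] and [- j] modulo [K2]; the smaller of the two
    residues ranges over [0, ..., `|n|]. *)
Lemma klein_nodal_count_bands v : m = 0 -> n != 0 ->
  nodal_count (eigfun (klein_bottle alpha) m n) v <-> v = (`|n| + 1)%N.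
Proof.
move=> m0 n0; rewrite eigE -[(`|n| + 1)%N]mul1n.
have K10 : K1 = 0%N by rewrite /K1 m0.
have K20 : (0 < K2)%N by rewrite /K2 muln_gt0 /= absz_gt0.
have e0 : e = 0 by rewrite /e m0.
have K20' : K2%:Z != 0 by rewrite eqz_nat -lt0n.
pose r (j : int) := `|(j %% K2)%Z|%N.
have rE j : r j = (j %% K2)%Z :> int by rewrite gez0_abs// modz_ge0.
have rlt j : (r j < K2)%N by rewrite -ltz_nat rE ltz_pmod.
have rN j : r (- j) = if r j == 0%N then 0%N else (K2 - r j)%N.
  have jE : j = (j %/ K2)%Z * K2 + r j by rewrite rE -divz_eq.
  case: eqP => [r0|r0].
    by rewrite /r {1}jE r0 addr0 -mulNr modzMl.
  have -> : - j = - ((j %/ K2)%Z + 1) * K2 + (K2 - r j)%N.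
    by rewrite {1}jE -subzn ?(ltnW (rlt j))//; ring.
  rewrite /r modzMDl modz_small// ltz_nat -/(r j); have := rlt j; lia.
pose lab (i j : int) := (0%N, minn (r j) (r (- j))).
have i0 p : Num.floor (A1 * p + 2^-1) = 0 :=
  @index_eq0 _ _ 1 _ (fun=> erefl) _ K10.
apply: (@nodal_count_grid _ g1 g2 phi phi1 phi2 A1 2^-1 A2 s2 lab _ _
          (fun t => ctr t.1 t.2) nzE).
- move=> p /nzE[_ h2]; rewrite /lab /= (index_shift a0 h2) /r.
  by rewrite opprD modzBr modzDr.
- by move=> p /nzE[_ h2]; rewrite /lab /= floor_g2y// e0 sub0r opprK minnC.
- move=> p /nzE[_ h2]; rewrite i0; set j := Num.floor _.
  have cell0 x k : cell A1 2^-1 A2 s2 0 k (x, center K2 alpha s2 k).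
    split => /=; first by have := i0 x; rewrite /A1 K10 !mul0r /between; lra.
    by apply: between_center => // k0; rewrite k0 in K20.
  have modc k : same_orbit g1 g2 (0, center K2 alpha s2 k) (0, center K2
    alpha s2 (r k)).
    have [|z ->] := @center_mod R K2 alpha s2 a0 k; first by move=> k0;
      rewrite k0 in K20.
    by rewrite rE; exact: orbit_y.
  have c0 : center K1 1 2^-1 0 = 0 :> R
    by rewrite /center K10 !mul0r invr0 mulr0.
  rewrite /lab /ctr /= c0; case: leqP => _.
    by exists (0, center K2 alpha s2 j); split.
  (* A glide changes the abscissa by 2^-1: starting from the point of the band
     with that abscissa, it leads to the line x = 0 of the base points. *)
  exists (2^-1, center K2 alpha s2 j); split => //.
  apply: same_orbit_trans (modc _);
    rewrite -[- j]add0r -e0 -(center_reflect K2 alpha _ eE).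
  by have := orbit_x 0 (center K2 alpha s2 j) 1; rewrite mul1r add0r.
- move=> p _; split => //=; rewrite /lab /= rN addn1 ltnS.
  move: (rlt (Num.floor (A2 * p.2 + s2))); move: (r _) => k; rewrite /K2.
  by case: eqP; lia.
move=> [i j] [/=]; rewrite ltnS leqn0 => /eqP -> jn; exists (ctr 0 j).
have j0 : K2 = 0%N -> j%:Z = 0 by move=> k0; rewrite k0 in K20.
split; first by apply: (cell_nz (i := 0) (j := j)); apply: ctrP.
rewrite /lab /= index_center// rN.
have -> : r j = j by rewrite /r modz_small// ltz_nat; move: jn n0;
  rewrite /K2; lia.
by congr pair; case: eqP => [->//|]; move: jn; rewrite /K2; lia.
Qed.

End Klein.

Lemma klein_nodal_data (R : realType) (alpha : R) : 0 < alpha ->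
  has_nodal_data (klein_bottle alpha) alpha (4 * pi ^+ 2) klein_nu.
Proof.
move=> a0; split; first by rewrite mulr_gt0// exprn_gt0 ?pi_gt0.
move=> m n adm; split=> [lambda|pos v]; first exact: klein_eigenpair.
have [m0|m0] := eqVneq m 0.
  have n0 : n != 0.
    apply: contraTneq pos => ->; rewrite m0 /energy !mulr0z !expr0n mulr0 addr0.
    by rewrite ltxx.
  rewrite klein_nodal_count_bands// /klein_nu m0 eqxx (negbTE n0).
  by rewrite absz0 !(mul0n, muln0, add0n, addn0, mul1n).
rewrite klein_nodal_count_cells// /klein_nu (negbTE m0) mul0n addn0.
by rewrite muln_eq0 /= absz_eq0 mulnDr mulnCA.
Qed.

Theorem theorem1 (R : realType) :
  [/\ forall alpha alpha' : R, 0 < alpha <= 1 -> 0 < alpha' <= 1 ->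
        nodal_sequence (rectangle alpha) = nodal_sequence (rectangle alpha') ->
        alpha = alpha',
      forall alpha alpha' : R, 0 < alpha <= 1 -> 0 < alpha' <= 1 ->
        nodal_sequence (torus alpha) = nodal_sequence (torus alpha') ->
        alpha = alpha'
    & forall alpha alpha' : R, 0 < alpha -> 0 < alpha' ->
        nodal_sequence (klein_bottle alpha) =
          nodal_sequence (klein_bottle alpha') ->
        alpha = alpha'] /\
  [/\ reconstructible [set alpha : R | 0 < alpha <= 1] (@rectangle R),
      reconstructible [set alpha : R | 0 < alpha <= 1] (@torus R)
    & reconstructible [set alpha : R | 0 < alpha] (@klein_bottle R)].
Proof.
have [rectR rectU] := rectangle_reconstruction (fun _ _ => erefl)
  (@rectangle_nodal_data R) (fun _ _ _ => iff_refl _).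
have [torR torU] := torus_reconstruction (fun _ _ => erefl)
  (@torus_nodal_data R) (fun _ _ _ => I).
have [kleR kleU] := klein_reconstruction (fun _ _ => erefl)
  (@klein_nodal_data R) (fun _ _ _ => iff_refl _).
by [].
Qed.
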